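(* For $d\ge2$, there exists $\varphi\in\mathrm{Mult}(H^2_d)$ such that $\operatorname{Re}V_\varphi$ is unbounded on $\mathbb{B}_d$.
   Context: $\mathbb{B}_d$ is the open Euclidean unit ball in $\mathbb{C}^d$. $H^2_d$ is the Drury--Arveson space, i.e. the reproducing kernel Hilbert space on $\mathbb{B}_d$ with kernel $K(z,w)=\frac{1}{1-\langle z,w\rangle}$. $\mathrm{Mult}(H^2_d)$ is the set of functions $\varphi:\mathbb{B}_d\to\mathbb{C}$ with $\varphi f\in H^2_d$ for all $f\in H^2_d$. For $f\in H^2_d$, the Sarason function of $f$ is $$V_f(z)=2\langle f,K(\cdot,z)f\rangle_{H^2_d}-\|f\|_{H^2_d}^2\qquad(z\in\mathbb{B}_d),$$ where $K(\cdot,z)f$ denotes the pointwise product (which lies in $H^2_d$). *)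

(* Defs.v *)
From mathcomp Require Import all_boot all_order all_algebra.
From mathcomp Require Import all_classical all_reals all_analysis.
From mathcomp Require Import complex spectral.
Set Implicit Arguments.
Unset Strict Implicit.
Unset Printing Implicit Defensive.
Import Order.TTheory GRing.Theory Num.Theory.
Import numFieldNormedType.Exports.
Local Open Scope classical_set_scope.
Local Open Scope ring_scope.

(* [dotmx z w] is \sum_i z_i * (w_i)^*, so the ball below is Euclidean, unlike
   the one given by the sup norm that MathComp-Analysis puts on 'rV. *)
Definition unit_ball (R : realType) (d : nat) : Type :=
  {z : 'rV[R[i]]_d | dotmx z z < 1}.

Definition norm_of (R : realType) (X : Type)
    (ip : (X -> R[i]) -> (X -> R[i]) -> R[i]) (f : X -> R[i]) : R :=
  Num.sqrt (complex.Re (ip f f)).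

(* A Hilbert space of functions on X with reproducing kernel K, with an inner
   product that is linear in its first argument. The values of [rkhs_ip]
   outside of [rkhs_set] are irrelevant. By the Moore-Aronszajn theorem K
   determines [rkhs_set] and the restriction of [rkhs_ip] to it, so a property
   of every [H : rkhs K] is a property of the RKHS with kernel K. *)
Record rkhs (R : realType) (X : Type) (K : X -> X -> R[i]) := RKHS {
  rkhs_set : set (X -> R[i]);
  rkhs_ip : (X -> R[i]) -> (X -> R[i]) -> R[i];
  rkhs_zero : rkhs_set (fun=> 0);
  rkhs_lin : forall (a : R[i]) f g, rkhs_set f -> rkhs_set g ->
    rkhs_set (fun x => a * f x + g x);
  rkhs_ip_linl : forall (a : R[i]) f g h,
    rkhs_set f -> rkhs_set g -> rkhs_set h ->
    rkhs_ip (fun x => a * f x + g x) h = a * rkhs_ip f h + rkhs_ip g h;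
  rkhs_ip_conj : forall f g, rkhs_set f -> rkhs_set g ->
    rkhs_ip g f = (rkhs_ip f g)^*;
  rkhs_ip_gt0 : forall f, rkhs_set f -> f <> (fun=> 0) -> 0 < rkhs_ip f f;
  rkhs_complete : forall u : nat -> X -> R[i],
    (forall n, rkhs_set (u n)) ->
    (forall e : R, 0 < e -> exists N : nat, forall m n : nat,
       (N <= m)%N -> (N <= n)%N ->
       norm_of rkhs_ip (fun x => u m x - u n x) < e) ->
    exists2 f, rkhs_set f &
      norm_of rkhs_ip (fun x => u n x - f x) @[n --> \oo] --> (0 : R);
  rkhs_kernel : forall w, rkhs_set (fun z => K z w);
  rkhs_reproducing : forall f w, rkhs_set f ->
    rkhs_ip f (fun z => K z w) = f w
}.

Definition Mult (R : realType) (X : Type) (K : X -> X -> R[i]) (H : rkhs K) :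
    set (X -> R[i]) :=
  [set phi | forall f, rkhs_set H f -> rkhs_set H (fun z => phi z * f z)].

Definition Sarason (R : realType) (X : Type) (K : X -> X -> R[i]) (H : rkhs K)
    (f : X -> R[i]) (z : X) : R[i] :=
  2 * rkhs_ip H f (fun w => K w z * f w) - (norm_of (rkhs_ip H) f)%:C%C ^+ 2.

Definition drury_arveson_kernel (R : realType) (d : nat)
    (z w : unit_ball R d) : R[i] :=
  1 / (1 - dotmx (sval z) (sval w)).

Definition drury_arveson (R : realType) (d : nat) : Type :=
  rkhs (@drury_arveson_kernel R d).

(* Main.v *)
Require Import Defs.
From mathcomp Require Import all_boot all_order all_algebra.
From mathcomp Require Import all_classical all_reals all_analysis.
From mathcomp Require Import complex spectral.
From mathcomp Require Import ring lra.
Set Implicit Arguments.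
Unset Strict Implicit.
Unset Printing Implicit Defensive.
Import Order.TTheory GRing.Theory Num.Theory.
Import numFieldNormedType.Exports.
Local Open Scope classical_set_scope.
Local Open Scope ring_scope.

(** Write [x_0], [x_1] for two coordinates of a point [x] of the ball. The
    multiplier behaves like [x_1 * (1 - x_0)^(-1/2)]. On functions of the form
    [x_1 * f(x_0)] the Drury-Arveson norm is the Bergman norm of [f], and for
    [z = r e_0] the real part of the Sarason function of [x_1 * psi(x_0)] is the
    integral of [|psi(w)|^2 (1 - r^2 |w|^2) / |1 - r w|^2] over the disc, for
    the normalised area measure [dA]. For [|psi(w)|^2] of size [1 / |1 - w|] this
    integral grows logarithmically as [r] tends to [1]. On the other hand
    [|psi|^2 dA] is a Carleson measure, so that [psi] multiplies the Hardy
    space into the Bergman space, and this makes [x_1 * psi(x_0)] a multiplier: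
    the factor [x_1] shifts the expansion in powers of [x_1], whose coefficients
    live in the spaces with kernels [(1 - z w^* )^(-k)], [k = 1, 2, ...].

    To have explicit inner products, [psi] is taken to be the dyadic sum of
    [8^-j / (1 - r_j w)^2] with [r_j = 1 - 4^-j]. The function
    [x_1 / (1 - r x_0)^2] is the derivative at [(r, 0)] in the direction of [x_1]
    of the reproducing kernel ([derivative_kernel_reproducing]), hence pairing
    with it is taking a derivative. Thus all the inner products needed for the
    Sarason function at [z = r_J e_0] are explicit and nonnegative, and each of
    the terms with [j < J] contributes at least [1/8] ([ip_kernel_times_ge]).

    That the sum is a multiplier reduces to the positivity of the kernels
    [(B - phi(x) phi(y)^* ) K(x, y)] for its partial sums [phi], with [B]
    independent of the number of terms ([Mult_of_psd], which rests on Riesz'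
    representation theorem [rkhs_set_of_bounded]). Such a kernel decomposes into
    products of positive kernels ([psd_dyadic_multiplier]), the only nontrivial
    one being [B / (1 - s)^2 - psi(x_0) psi(y_0)^* / (1 - s)], [s = x_0 y_0^*]
    ([psd_carleson]). Its positivity is the boundedness of multiplication by
    [psi] from Hardy to Bergman space; since the Taylor coefficients of [psi] are
    [O(n^(-1/2))] ([dyadic_coef_le]), it follows from Schur's test
    ([rsqrt_carleson]). *)

(** * Limits of sequences in a number field *)

(** Convergence is wrapped so that it is stated over an abstract number field:
    the complex numbers [R[i]] then need no topology of their own. *)
Definition tends (F : numFieldType) (u : nat -> F) (l : F) : Prop :=
  u n @[n --> \oo] --> l.

Section Tends.
Variable F : numFieldType.
Implicit Types (u v : nat -> F) (a b : F).

Lemma tendsP u a :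
  tends u a <-> forall e, 0 < e -> exists N : nat, forall n, (N <= n)%N -> `|u n - a| < e.
Proof.
split=> [/cvgrPdist_lt h e /h [N _ hN]|h].
  by exists N => n /hN; rewrite distrC.
by apply/cvgrPdist_lt => e /h [N hN]; exists N => // n /hN; rewrite distrC.
Qed.

Lemma tends_cst a : tends (fun=> a) a.
Proof. exact: cvg_cst. Qed.

Arguments tends_cst a : clear implicits.

Lemma tends_ext u v a : u =1 v -> tends u a -> tends v a.
Proof. by move=> /funext ->. Qed.

Lemma tendsD u v a b : tends u a -> tends v b -> tends (fun n => u n + v n) (a + b).
Proof. exact: cvgD. Qed.

Lemma tendsB u v a b : tends u a -> tends v b -> tends (fun n => u n - v n) (a - b).
Proof. exact: cvgB. Qed.

Lemma tendsM u v a b : tends u a -> tends v b -> tends (fun n => u n * v n) (a * b).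
Proof. exact: cvgM. Qed.

Lemma tendsV u a : a != 0 -> tends u a -> tends (fun n => (u n)^-1) a^-1.
Proof. exact: cvgV. Qed.

Lemma tends_norm u a : tends u a -> tends (fun n => `|u n|) `|a|.
Proof. exact: cvg_norm. Qed.

Lemma tends_sum (I : Type) (s : seq I) (u : I -> nat -> F) (a : I -> F) :
  (forall i, tends (u i) (a i)) ->
  tends (fun n => \sum_(i <- s) u i n) (\sum_(i <- s) a i).
Proof.
move=> h; elim: s => [|i s IH].
  under [X in tends X]eq_fun do rewrite big_nil.
  by rewrite big_nil; exact: tends_cst.
under [X in tends X]eq_fun do rewrite big_cons.
by rewrite big_cons; exact: tendsD.
Qed.

Lemma tends_unique u a b : tends u a -> tends u b -> a = b.
Proof. by apply: cvg_unique; exact: norm_hausdorff. Qed.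

Lemma tends_shift u a (N : nat) : tends u a -> tends (fun n => u (N + n)%N) a.
Proof.
move=> /tendsP h; apply/tendsP => e /h [M hM]; exists M => n Mn.
by apply: hM; rewrite (leq_trans Mn) ?leq_addl.
Qed.

(** In a number field [0 <= x] means [`|x| = x], which passes to the limit. *)
Lemma tends_ge0 u a : (forall n, 0 <= u n) -> tends u a -> 0 <= a.
Proof.
move=> u0 ua; have := tends_norm ua.
have -> : (fun n => `|u n|) = u by apply/funext => n; rewrite ger0_norm.
by move=> /(tends_unique ua) ->.
Qed.

Lemma tends_le u v a b :
  (forall n, u n <= v n) -> tends u a -> tends v b -> a <= b.
Proof.
move=> uv ua vb; rewrite -subr_ge0; apply: tends_ge0 (tendsB vb ua) => n.
by rewrite subr_ge0.
Qed.

End Tends.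
Arguments tends_cst {F} a.

Lemma tends_conj (K : numClosedFieldType) (u : nat -> K) (a : K) :
  tends u a -> tends (fun n => (u n)^*) a^*.
Proof.
move=> /tendsP h; apply/tendsP => e /h [N hN]; exists N => n /hN.
by rewrite -rmorphB norm_conjC.
Qed.

Section TendsComplex.
Variable R : realType.
Implicit Types (u : nat -> R[i]) (a : R[i]) (b : nat -> R).

Lemma tends_dominated u a b :
  (forall n, `|u n - a| <= (b n)%:C%C) -> b n @[n --> \oo] --> (0 : R) -> tends u a.
Proof.
move=> h hb; apply/tendsP => e e0.
have eE : (complex.Re e)%:C%C = e by rewrite RRe_real // gtr0_real.
move/cvgr0Pnorm_lt : hb => /(_ (complex.Re e)) H.
have : 0 < complex.Re e by move: e0; rewrite -{1}eE ltcR.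
move=> /H[N _ hN]; exists N => n /hN hn.
by rewrite -eE (le_lt_trans (h n)) // ltcR (le_lt_trans (ler_norm _)).
Qed.

Lemma tends_real b (x : R) : b n @[n --> \oo] --> x ->
  tends (fun n => (b n)%:C%C) x%:C%C.
Proof.
move=> bx; apply: (@tends_dominated _ _ (fun n => `|b n - x|)) => [n|].
  by rewrite -rmorphB normc_def /= expr0n addr0 sqrtr_sqr.
rewrite -(normr0 R) -(subrr x); apply: cvg_norm.
exact: cvgB bx (cvg_cst x).
Qed.

End TendsComplex.

(** * Reproducing kernel Hilbert spaces *)

Section Rkhs.
Variables (R : realType) (X : Type) (K : X -> X -> R[i]) (H : rkhs K).
Local Notation C := R[i].
Local Notation ip := (rkhs_ip H).
Local Notation S := (rkhs_set H).
Implicit Types (f g h : X -> C) (a b : C) (x y : X).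

Lemma rkhs_setZ a f : S f -> S (fun x => a * f x).
Proof.
move=> Sf; have := rkhs_lin a Sf (rkhs_zero H).
by congr (S _); apply/funext => x; rewrite addr0.
Qed.

Lemma rkhs_setD f g : S f -> S g -> S (fun x => f x + g x).
Proof.
move=> Sf Sg; have := rkhs_lin 1 Sf Sg.
by congr (S _); apply/funext => x; rewrite mul1r.
Qed.

Lemma rkhs_setB f g : S f -> S g -> S (fun x => f x - g x).
Proof.
move=> Sf Sg; have := rkhs_lin (-1) Sg Sf.
by congr (S _); apply/funext => x; rewrite mulN1r addrC.
Qed.

Lemma rkhs_ip0l h : S h -> ip (fun=> 0) h = 0.
Proof.
move=> Sh; have := rkhs_ip_linl (-1) (rkhs_zero H) (rkhs_zero H) Sh.
have -> : (fun x : X => -1 * 0 + 0 : C) = fun=> 0.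
  by apply/funext => x; rewrite mulr0 addr0.
by rewrite mulN1r addNr.
Qed.

Lemma rkhs_ipDl f g h : S f -> S g -> S h ->
  ip (fun x => f x + g x) h = ip f h + ip g h.
Proof.
move=> Sf Sg Sh; rewrite -[ip f h]mul1r -rkhs_ip_linl //.
by congr (ip _ h); apply/funext => x; rewrite mul1r.
Qed.

Lemma rkhs_ipZl a f h : S f -> S h -> ip (fun x => a * f x) h = a * ip f h.
Proof.
move=> Sf Sh; rewrite -[RHS]addr0 -(rkhs_ip0l Sh) -rkhs_ip_linl //.
  by congr (ip _ h); apply/funext => x; rewrite addr0.
exact: rkhs_zero.
Qed.

Lemma rkhs_ipBl f g h : S f -> S g -> S h ->
  ip (fun x => f x - g x) h = ip f h - ip g h.
Proof.
move=> Sf Sg Sh; rewrite -[- ip g h]mulN1r -rkhs_ipZl // -rkhs_ipDl //.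
  by congr (ip _ h); apply/funext => x; rewrite mulN1r.
exact: rkhs_setZ.
Qed.

Lemma rkhs_ipDr f g h : S f -> S g -> S h ->
  ip h (fun x => f x + g x) = ip h f + ip h g.
Proof.
move=> Sf Sg Sh; rewrite [LHS]rkhs_ip_conj //; last exact: rkhs_setD.
by rewrite rkhs_ipDl // rmorphD /= -!rkhs_ip_conj.
Qed.

Lemma rkhs_ipZr a f h : S f -> S h -> ip h (fun x => a * f x) = a^* * ip h f.
Proof.
move=> Sf Sh; rewrite [LHS]rkhs_ip_conj //; last exact: rkhs_setZ.
by rewrite rkhs_ipZl // rmorphM /= -rkhs_ip_conj.
Qed.

Lemma rkhs_ipBr f g h : S f -> S g -> S h ->
  ip h (fun x => f x - g x) = ip h f - ip h g.
Proof.
move=> Sf Sg Sh; rewrite [LHS]rkhs_ip_conj //; last exact: rkhs_setB.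
by rewrite rkhs_ipBl // rmorphB /= -!rkhs_ip_conj.
Qed.

Lemma rkhs_set_sum (I : Type) (s : seq I) (c : I -> C) (F : I -> X -> C) :
  (forall i, S (F i)) -> S (fun x => \sum_(i <- s) c i * F i x).
Proof.
move=> SF; elim: s => [|i s IH].
  under [X in S X]eq_fun do rewrite big_nil.
  exact: rkhs_zero.
under [X in S X]eq_fun do rewrite big_cons.
exact: rkhs_lin.
Qed.

Lemma rkhs_ip_suml (I : Type) (s : seq I) (c : I -> C) (F : I -> X -> C) h :
  (forall i, S (F i)) -> S h ->
  ip (fun x => \sum_(i <- s) c i * F i x) h = \sum_(i <- s) c i * ip (F i) h.
Proof.
move=> SF Sh; elim: s => [|i s IH].
  under [X in ip X _]eq_fun do rewrite big_nil.
  by rewrite big_nil rkhs_ip0l.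
under [X in ip X _]eq_fun do rewrite big_cons.
by rewrite big_cons rkhs_ip_linl ?IH //; exact: rkhs_set_sum.
Qed.

Lemma rkhs_ip_ge0 f : S f -> 0 <= ip f f.
Proof.
move=> Sf; have [->|f0] := pselect (f = fun=> 0).
  by rewrite rkhs_ip0l //; exact: rkhs_zero.
exact/ltW/rkhs_ip_gt0.
Qed.

Lemma norm_of_sqr f : S f -> ((norm_of ip f) ^+ 2)%:C%C = ip f f.
Proof.
move=> Sf; rewrite /norm_of; have := rkhs_ip_ge0 Sf.
case: (ip f f) => x y; rewrite lecE /= => /andP[/eqP -> x0].
by rewrite sqr_sqrtr.
Qed.

Lemma norm_of_ge0 f : 0 <= norm_of ip f.
Proof. exact: sqrtr_ge0. Qed.

Lemma rkhs_Cauchy_Schwarz f g : S f -> S g -> `|ip f g| ^+ 2 <= ip f f * ip g g.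
Proof.
move=> Sf Sg; have [g0|g0] := pselect (g = fun=> 0).
  rewrite g0 (rkhs_ip_conj (rkhs_zero H) Sf) !rkhs_ip0l //; last exact: rkhs_zero.
  by rewrite conjC0 normr0 expr0n mulr0.
have k0 := rkhs_ip_gt0 Sg g0; set k := ip g g in k0 *.
have kr : k^* = k by rewrite /k -rkhs_ip_conj.
pose t := ip f g / k; have St := rkhs_setZ t Sg.
have := rkhs_ip_ge0 (rkhs_setB Sf St).
rewrite rkhs_ipBl ?rkhs_ipBr ?rkhs_ipZl ?rkhs_ipZr //; last exact: rkhs_setB.
rewrite (rkhs_ip_conj Sf Sg) -/k /t rmorphM /= fmorphV /= kr.
have -> : ip f f - (ip f g)^* / k * ip f g -
  (ip f g / k * (ip f g)^* - ip f g / k * ((ip f g)^* / k * k)) =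
  ip f f - ip f g * (ip f g)^* / k.
  by rewrite divfK ?gt_eqF //; ring.
by rewrite subr_ge0 ler_pdivrMr // normCK.
Qed.

Lemma rkhs_ip_le f g : S f -> S g ->
  `|ip f g| <= (norm_of ip f * norm_of ip g)%:C%C.
Proof.
move=> Sf Sg; rewrite -(@ler_pXn2r _ 2) ?nnegrE ?normr_ge0 ?ler0c ?mulr_ge0 ?norm_of_ge0 //.
rewrite [X in _ <= X](_ : _ = ip f f * ip g g); first exact: rkhs_Cauchy_Schwarz.
by rewrite -!norm_of_sqr // -rmorphXn -rmorphM exprMn.
Qed.

(** Completeness, in a form which hides the norm: the limit is only used
    through its inner products, in particular its values. *)
Lemma rkhs_cvg (u : nat -> X -> C) (b : nat -> R) :
  (forall n, S (u n)) -> b n @[n --> \oo] --> (0 : R) ->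
  (forall m n, ip (fun x => u m x - u n x) (fun x => u m x - u n x)
     <= (b m + b n)%:C%C) ->
  exists2 f, S f & forall g, S g -> tends (fun n => ip (u n) g) (ip f g).
Proof.
move=> Su b0 ub; have [|f Sf fu] := rkhs_complete Su.
  move=> e e0; have e2 : 0 < e ^+ 2 / 2 by rewrite divr_gt0 ?exprn_gt0.
  move/cvgr0Pnorm_lt : b0 => /(_ _ e2)[N _ hN]; exists N => m n /hN hm /hN hn.
  rewrite -(@ltr_pXn2r _ 2) ?nnegrE ?norm_of_ge0 ?(ltW e0) //.
  rewrite -ltcR norm_of_sqr; last exact: rkhs_setB.
  rewrite (le_lt_trans (ub m n)) // ltcR (splitr (e ^+ 2)) ltrD //.
    exact: le_lt_trans (ler_norm _) hm.
  exact: le_lt_trans (ler_norm _) hn.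
exists f => // g Sg.
apply: (@tends_dominated _ _ _
    (fun n => norm_of ip (fun x => u n x - f x) * norm_of ip g)) => [n|].
  by rewrite -rkhs_ipBl //; apply: rkhs_ip_le => //; exact: rkhs_setB.
rewrite -[X in _ --> X](mul0r (norm_of ip g)).
by apply: cvgM => //; exact: cvg_cst.
Qed.

Lemma rkhs_kernel_conj x y : (K x y)^* = K y x.
Proof.
rewrite -(rkhs_reproducing x (rkhs_kernel H y)).
by rewrite -rkhs_ip_conj ?rkhs_reproducing; do ?exact: rkhs_kernel.
Qed.

Lemma conj_real (r : R) : (r%:C%C : C)^* = r%:C%C.
Proof. exact: conjc_real. Qed.

Lemma rkhs_ip_kernel_diff (a : R) x y f : S f ->
  ip f (fun w => a%:C%C * (K w x - K w y)) = a%:C%C * (f x - f y).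
Proof.
move=> Sf; have Sk := rkhs_kernel H.
rewrite rkhs_ipZr //; last exact: rkhs_setB.
by rewrite rkhs_ipBr // !rkhs_reproducing // conj_real.
Qed.

Lemma rkhs_ip_diff f g (a b c : R) : S f -> S g ->
  ip f f = a%:C%C -> ip g g = b%:C%C -> ip f g = c%:C%C ->
  ip (fun x => f x - g x) (fun x => f x - g x) = (a + b - 2 * c)%:C%C.
Proof.
move=> Sf Sg fa gb fc; have Sd := rkhs_setB Sf Sg.
rewrite rkhs_ipBl // !rkhs_ipBr // (rkhs_ip_conj Sf Sg) fa gb fc conj_real.
by rewrite rmorphB rmorphD rmorphM rmorph_nat; ring.
Qed.

End Rkhs.

(** * Positive semidefinite kernels and multipliers *)

Section Psd.
Variables (R : realType) (X : Type).
Local Notation C := R[i].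
Implicit Types (P Q : X -> X -> C) (c : seq (C * X)).

(** The order of the two points is that of the Gram matrix: for a reproducing
    kernel this is the squared norm of [\sum_p p.1 * K _ p.2]. *)
Definition quad P c : C :=
  \sum_(p <- c) \sum_(q <- c) p.1 * (q.1)^* * P q.2 p.2.

Definition psd P : Prop := forall c, 0 <= quad P c.

End Psd.

Section Membership.
Variables (R : realType) (X : Type) (K : X -> X -> R[i]) (H : rkhs K).
Local Notation C := R[i].
Local Notation ip := (rkhs_ip H).
Local Notation S := (rkhs_set H).
Local Notation Re := (@complex.Re R).
Implicit Types (f g h : X -> C) (a b : C) (x y : X) (c : seq (C * X)).

Definition kernel_comb c : X -> C := fun z => \sum_(p <- c) p.1 * K z p.2.

(** When [g] is in the space this is the inner product of [kernel_comb c] with [g]. *)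
Definition comb_eval g c : C := \sum_(p <- c) p.1 * (g p.2)^*.

Lemma kernel_comb_set c : S (kernel_comb c).
Proof.
by apply: (@rkhs_set_sum _ _ _ H _ _ _ (fun p z => K z p.2)) => p; exact: rkhs_kernel.
Qed.

Lemma rkhs_ip_kernell f x : S f -> ip (fun z => K z x) f = (f x)^*.
Proof.
by move=> Sf; rewrite (rkhs_ip_conj Sf (rkhs_kernel H x)) rkhs_reproducing.
Qed.

Lemma ip_kernel_comb c f : S f -> ip (kernel_comb c) f = comb_eval f c.
Proof.
move=> Sf; rewrite (@rkhs_ip_suml _ _ _ H _ _ _ (fun p z => K z p.2)) //.
  by apply: eq_bigr => p _; rewrite rkhs_ip_kernell.
by move=> p; exact: rkhs_kernel.
Qed.

Lemma quad_kernel c : quad K c = ip (kernel_comb c) (kernel_comb c).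
Proof.
rewrite ip_kernel_comb; last exact: kernel_comb_set.
apply: eq_bigr => p _; rewrite rmorph_sum mulr_sumr; apply: eq_bigr => q _.
by rewrite rmorphM /= (rkhs_kernel_conj H) mulrA.
Qed.

Lemma kernel_comb_cat c c' :
  kernel_comb (c ++ c') = (fun x => kernel_comb c x + kernel_comb c' x).
Proof. by apply/funext => x; rewrite /kernel_comb big_cat. Qed.

Lemma comb_eval_cat g c c' : comb_eval g (c ++ c') = comb_eval g c + comb_eval g c'.
Proof. by rewrite /comb_eval big_cat. Qed.

Definition scale_comb a c := [seq (a * p.1, p.2) | p <- c].

Lemma kernel_comb_scale a c :
  kernel_comb (scale_comb a c) = (fun x => a * kernel_comb c x).
Proof.
apply/funext => x; rewrite /kernel_comb big_map mulr_sumr.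
by apply: eq_bigr => p _; rewrite mulrA.
Qed.

Lemma comb_eval_scale g a c : comb_eval g (scale_comb a c) = a * comb_eval g c.
Proof.
by rewrite /comb_eval big_map mulr_sumr; apply: eq_bigr => p _; rewrite mulrA.
Qed.

(** The functional minimised in the proof of Riesz' theorem. *)
Definition riesz_energy g c : R :=
  Re (ip (kernel_comb c) (kernel_comb c)) - 2 * Re (comb_eval g c).

Lemma riesz_energy_cat g c c' :
  riesz_energy g (c ++ c') = riesz_energy g c + riesz_energy g c'
    + 2 * Re (ip (kernel_comb c) (kernel_comb c')).
Proof.
have [Sc Sc'] := (kernel_comb_set c, kernel_comb_set c').
rewrite /riesz_energy comb_eval_cat kernel_comb_cat.
rewrite rkhs_ipDl ?rkhs_ipDr //; last exact: rkhs_setD.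
rewrite (rkhs_ip_conj Sc Sc').
move: (ip _ _) (ip _ _) (ip _ _) (comb_eval g c) (comb_eval g c').
move=> [x1 y1] [x2 y2] [x3 y3] [x4 y4] [x5 y5] /=; ring.
Qed.

Lemma riesz_energy_scale g (t : R) c :
  riesz_energy g (scale_comb t%:C%C c) =
    t ^+ 2 * Re (ip (kernel_comb c) (kernel_comb c)) - 2 * t * Re (comb_eval g c).
Proof.
have Sc := kernel_comb_set c.
rewrite /riesz_energy comb_eval_scale kernel_comb_scale.
rewrite rkhs_ipZl ?rkhs_ipZr //; last exact: rkhs_setZ.
move: (ip _ _) (comb_eval g c).
move=> [x1 y1] [x2 y2] /=; ring.
Qed.

Lemma riesz_energy_point g c x (s : R) (z := kernel_comb c x - g x) :
  riesz_energy g (c ++ [:: (- s%:C%C * z, x)]) =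
  riesz_energy g c + Re (`|z| ^+ 2) * (s ^+ 2 * Re (K x x) - 2 * s).
Proof.
have Sx := rkhs_kernel H x; have Sc := kernel_comb_set c.
have -> : [:: (- s%:C%C * z, x)] = scale_comb (- s%:C%C * z) [:: (1, x)].
  by rewrite /scale_comb /= mulr1.
have Ex : kernel_comb [:: (1, x)] = fun w => K w x.
  by apply/funext => w; rewrite /kernel_comb big_seq1 mul1r.
have Lx : comb_eval g [:: (1, x)] = (g x)^* by rewrite /comb_eval big_seq1 mul1r.
rewrite riesz_energy_cat /riesz_energy comb_eval_scale kernel_comb_scale Ex Lx.
rewrite rkhs_ipZl ?rkhs_ipZr ?rkhs_reproducing //; last exact: rkhs_setZ.
rewrite normCK; have -> : kernel_comb c x = z + g x by rewrite subrK.
move: z (g x) (K x x) (ip _ _) (comb_eval g c).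
move=> [x1 y1] [x2 y2] [x3 y3] [x4 y4] [x5 y5] /=; ring.
Qed.

(** If the energy at [c] is within [e] of its infimum, then [c] almost
    represents evaluation against [g]: otherwise adding a small multiple of the
    kernel at [x] would lower the energy below the infimum. *)
Lemma riesz_energy_near_inf g c x (m e : R) : 0 <= e ->
  (forall c', m <= riesz_energy g c') -> riesz_energy g c <= m + e ^+ 2 ->
  `|kernel_comb c x - g x| <= (e * (Re (K x x) + 1))%:C%C.
Proof.
move=> e0 hm hc; set k := Re (K x x).
have k0 : 0 <= k.
  have := rkhs_ip_ge0 (rkhs_kernel H x).
  by rewrite rkhs_reproducing ?lecE /=; [case/andP | exact: rkhs_kernel].
have := hm (c ++ [:: (- (k + 1)^-1%:C%C * (kernel_comb c x - g x), x)]).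
rewrite riesz_energy_point -/k; set z := kernel_comb c x - g x.
rewrite normc_def; set n := Num.sqrt _.
have n0 : 0 <= n by exact: sqrtr_ge0.
have -> : Re (n%:C%C ^+ 2) = n ^+ 2 by rewrite -rmorphXn.
set s := (k + 1)^-1 => h; have s0 : 0 < s by rewrite invr_gt0 ltr_wpDl.
have sk : s * (k + 1) = 1 by rewrite mulVf // gt_eqF // ltr_wpDl.
have {h hc} h : n ^+ 2 * s <= e ^+ 2.
  have : n ^+ 2 * (s ^+ 2 * k - 2 * s) <= n ^+ 2 * (- s).
    have -> : s ^+ 2 * k - 2 * s = s * (s * (k + 1)) - s ^+ 2 - 2 * s by ring.
    by rewrite sk ler_wpM2l ?sqr_ge0 //; have := sqr_ge0 s; lra.
  by move: h hc; rewrite mulrN; lra.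
rewrite lecR -(@ler_pXn2r _ 2) ?nnegrE ?mulr_ge0 ?addr_ge0 //.
have : n ^+ 2 * s * (k + 1) <= e ^+ 2 * (k + 1) by rewrite ler_wpM2r ?addr_ge0.
rewrite -mulrA sk mulr1 exprMn => /le_trans; apply.
by rewrite ler_wpM2l ?sqr_ge0 // expr2 ler_peMl ?addr_ge0 // lerDr.
Qed.

(** Two combinations whose energies are near the infimum are near each other,
    by the parallelogram law applied to them and their midpoint. *)
Lemma riesz_energy_parallelogram g c c' (m : R) :
  (forall c, m <= riesz_energy g c) ->
  ip (fun x => kernel_comb c x - kernel_comb c' x)
     (fun x => kernel_comb c x - kernel_comb c' x)
  <= (2 * (riesz_energy g c - m) + 2 * (riesz_energy g c' - m))%:C%C.
Proof.
move=> hm; have [Sc Sc'] := (kernel_comb_set c, kernel_comb_set c').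
have Sd := rkhs_setB Sc Sc'.
rewrite -(norm_of_sqr Sd) lecR.
have -> : norm_of ip (fun x => kernel_comb c x - kernel_comb c' x) ^+ 2 =
    Re (ip (fun x => kernel_comb c x - kernel_comb c' x)
      (fun x => kernel_comb c x - kernel_comb c' x)).
  by rewrite -(norm_of_sqr Sd).
have := hm (scale_comb (2^-1)%:C%C (c ++ c')).
rewrite riesz_energy_scale comb_eval_cat kernel_comb_cat /riesz_energy.
rewrite rkhs_ipBl // !rkhs_ipBr // rkhs_ipDl ?rkhs_ipDr //; last exact: rkhs_setD.
rewrite (rkhs_ip_conj Sc Sc').
move: (ip _ _) (ip _ _) (ip _ _) (comb_eval g c) (comb_eval g c').
move=> [x1 y1] [x2 y2] [x3 y3] [x4 y4] [x5 y5] /=.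
have -> : 2^-1 ^+ 2 = 4^-1 :> R by rewrite exprVn -natrX.
lra.
Qed.

(** Riesz' theorem for the bounded functional [K_x |-> (g x)^*]: combinations
    minimising the energy converge, and the values of the limit are those of
    [g]. *)
Lemma rkhs_set_of_bounded g (B : R) : 0 <= B ->
  (forall c, `|comb_eval g c| ^+ 2 <= B%:C%C * quad K c) -> S g.
Proof.
move=> B0 hB; pose E := range (riesz_energy g).
have lbE : lbound E (- B).
  move=> _ [c _ <-]; have := hB c; rewrite quad_kernel.
  have := rkhs_ip_ge0 (kernel_comb_set c).
  rewrite /riesz_energy normCK.
  case: (ip _ _) (comb_eval g c) => [x y] [u v]; rewrite !lecE /= => /andP[_ x0].
  move=> /andP[_ h].
  have h2 : u ^+ 2 <= B * x by have := sqr_ge0 v; move: h; rewrite -!expr2; lra.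
  have : (2 * u) ^+ 2 <= (B + x) ^+ 2.
    have := sqr_ge0 (B - x); rewrite !expr2 in h2 *; lra.
  rewrite -(real_normK (num_real (2 * u))) ler_pXn2r ?nnegrE ?addr_ge0 //.
  by move=> /ler_normlW; lra.
have infE : has_inf E by split; [exists (riesz_energy g [::]); exists [::] | exists (- B)].
set m := inf E; have hm c : m <= riesz_energy g c.
  by apply: ge_inf; [exists (- B) | exists c].
pose e n : R := n.+1%:R^-1.
have e0 n : 0 < e n by rewrite invr_gt0.
have /choice[c hc] : forall n, exists c, riesz_energy g c <= m + e n ^+ 2.
  move=> n; have [|_ [c _ <-] hc] := @inf_adherent _ E (e n ^+ 2) _ infE.
    by rewrite exprn_gt0.
  by exists c; exact: ltW.
have eto0 : e n @[n --> \oo] --> (0 : R) by exact: cvg_harmonic.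
have [|||f Sf hf] := @rkhs_cvg _ _ _ H (fun n => kernel_comb (c n)) (fun n => 2 * e n) _ _ _.
- by move=> n; exact: kernel_comb_set.
- by rewrite -(mulr0 2); apply: cvgM => //; exact: cvg_cst.
- move=> p q; apply: le_trans (riesz_energy_parallelogram _ _ hm) _.
  have h n : 2 * (riesz_energy g (c n) - m) <= 2 * e n.
    rewrite ler_wpM2l // lerBlDl (le_trans (hc _)) // lerD2l expr2.
    by rewrite ler_piMl ?(ltW (e0 _)) // /e invf_le1 ?ltr0n ?ler1n.
  by rewrite lecR lerD.
suff -> : g = f by [].
apply/funext => x; apply: (@tends_unique _ (fun n => kernel_comb (c n) x)).
  apply: (@tends_dominated _ _ _ (fun n => e n * (Re (K x x) + 1))) => [n|].
    by apply: riesz_energy_near_inf hm (hc n); exact: ltW.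
  rewrite -(mul0r (Re (K x x) + 1)).
  by apply: cvgM => //; exact: cvg_cst.
have := hf _ (rkhs_kernel H x); rewrite rkhs_reproducing //.
under [X in tends X]eq_fun do (rewrite rkhs_reproducing; last exact: kernel_comb_set).
by [].
Qed.

End Membership.

Section Multipliers.
Variables (R : realType) (X : Type) (K : X -> X -> R[i]) (H : rkhs K).
Local Notation C := R[i].

(** Multiplication by [phi] has an adjoint which maps the kernel at [x] to
    [(phi x)^*] times itself; positivity says that this map is bounded on
    combinations of kernels. Only the pointwise limit of the [phi_ n] has to be
    known, as the bound is the same for all [n]. *)
Lemma Mult_of_psd (phi_ : nat -> X -> C) (phi : X -> C) (B : R) : 0 <= B ->
  (forall x, tends (fun n => phi_ n x) (phi x)) ->
  (forall n, psd (fun x y => (B%:C%C - phi_ n x * (phi_ n y)^*) * K x y)) ->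
  Mult H phi.
Proof.
move=> B0 hphi hpsd f Sf; pose A := norm_of (rkhs_ip H) f ^+ 2.
apply: (@rkhs_set_of_bounded _ _ _ H _ (A * B)); first by rewrite mulr_ge0 ?sqr_ge0.
move=> c.
have le_n n : `|comb_eval (fun x => phi_ n x * f x) c| ^+ 2 <= (A * B)%:C%C * quad K c.
  pose c' := [seq (p.1 * (phi_ n p.2)^*, p.2) | p <- c].
  have -> : comb_eval (fun x => phi_ n x * f x) c = comb_eval f c'.
    rewrite /comb_eval big_map; apply: eq_bigr => p _.
    by rewrite rmorphM mulrA.
  rewrite -(ip_kernel_comb _ Sf).
  apply: le_trans (rkhs_Cauchy_Schwarz (kernel_comb_set H c') Sf) _.
  rewrite mulrC -(norm_of_sqr Sf) -/A [(A * B)%:C%C]rmorphM -[X in _ <= X]mulrA.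
  rewrite ler_wpM2l ?ler0c ?sqr_ge0 //.
  rewrite -(quad_kernel H) -subr_ge0; have := hpsd n c.
  congr (0 <= _); rewrite /quad big_map mulr_sumr -sumrB; apply: eq_bigr => p _.
  rewrite big_map mulr_sumr -sumrB; apply: eq_bigr => q _ /=.
  by rewrite rmorphM /= conjCK; ring.
have lim : tends (fun n => comb_eval (fun x => phi_ n x * f x) c)
                 (comb_eval (fun x => phi x * f x) c).
  apply: tends_sum => p; apply: tendsM; first exact: tends_cst.
  by apply: tends_conj; apply: tendsM => //; exact: tends_cst.
exact: tends_le le_n (tendsM (tends_norm lim) (tends_norm lim)) (tends_cst _).
Qed.

End Multipliers.

(** * Kernels that preserve positivity under pointwise products *)

Section SchurStable.
Variables (R : realType) (X : Type).
Local Notation C := R[i].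
Implicit Types (P Q M N : X -> X -> C) (g : X -> C).

Lemma psd_ext P Q : (forall x y, P x y = Q x y) -> psd P -> psd Q.
Proof.
by move=> PQ; congr psd; apply/funext => x; apply/funext => y; exact: PQ.
Qed.

Lemma psd0 : psd (fun _ _ : X => 0 : C).
Proof.
by move=> c; rewrite /quad big1 // => p _; rewrite big1 // => q _; rewrite mulr0.
Qed.

Lemma psdD P Q : psd P -> psd Q -> psd (fun x y => P x y + Q x y).
Proof.
move=> hP hQ c; have := addr_ge0 (hP c) (hQ c); congr (0 <= _).
rewrite /quad -big_split; apply: eq_bigr => p _; rewrite -big_split.
by apply: eq_bigr => q _; rewrite mulrDr.
Qed.

Lemma psd_tends (P_ : nat -> X -> X -> C) P :
  (forall x y, tends (fun n => P_ n x y) (P x y)) -> (forall n, psd (P_ n)) ->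
  psd P.
Proof.
move=> hP hpsd c; apply: (@tends_ge0 _ (fun n => quad (P_ n) c)).
  by move=> n; exact: hpsd.
apply: tends_sum => p; apply: tends_sum => q; apply: tendsM => //.
exact: tends_cst.
Qed.

(** By Schur's product theorem this amounts to positivity. For limits of sums of
    products of rank one kernels, such as the kernels below, it is elementary. *)
Definition schur_stable M := forall P, psd P -> psd (fun x y => M x y * P x y).

Lemma schur_stable_psd M : schur_stable M -> psd M.
Proof.
move=> hM; apply: (@psd_ext (fun x y => M x y * 1)); first by move=> x y; rewrite mulr1.
apply: hM => c; rewrite /quad.
have -> : \sum_(p <- c) \sum_(q <- c) p.1 * (q.1)^* * 1 =
    (\sum_(p <- c) p.1) * (\sum_(p <- c) p.1)^*.
  rewrite mulr_suml; apply: eq_bigr => p _; rewrite rmorph_sum mulr_sumr.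
  by apply: eq_bigr => q _; rewrite mulr1.
exact: mul_conjC_ge0.
Qed.

Lemma schur_stable_rank1 g : schur_stable (fun x y => g x * (g y)^*).
Proof.
move=> P hP c; have := hP [seq (p.1 * (g p.2)^*, p.2) | p <- c].
congr (0 <= _); rewrite /quad big_map; apply: eq_bigr => p _.
rewrite big_map; apply: eq_bigr => q _ /=.
by rewrite rmorphM /= conjCK; ring.
Qed.

Lemma schur_stable_cst (a : R) : 0 <= a -> schur_stable (fun _ _ => a%:C%C).
Proof.
move=> a0; have := schur_stable_rank1 (fun=> (Num.sqrt a)%:C%C).
congr schur_stable; apply/funext => x; apply/funext => y.
by rewrite -normCK normc_def /= expr0n addr0 -rmorphXn /= !sqr_sqrtr ?sqr_ge0.
Qed.

Lemma schur_stableD M N : schur_stable M -> schur_stable N ->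
  schur_stable (fun x y => M x y + N x y).
Proof.
move=> hM hN P hP; apply: psd_ext (psdD (hM _ hP) (hN _ hP)) => x y.
by rewrite mulrDl.
Qed.

Lemma schur_stableM M N : schur_stable M -> schur_stable N ->
  schur_stable (fun x y => M x y * N x y).
Proof.
move=> hM hN P hP; apply: psd_ext (hM _ (hN _ hP)) => x y.
by rewrite mulrA.
Qed.

Lemma schur_stableX M n : schur_stable M -> schur_stable (fun x y => M x y ^+ n).
Proof.
move=> hM; elim: n => [|n IH]; first exact: (@schur_stable_cst 1 ler01).
move=> P hP; apply: psd_ext (schur_stableM hM IH hP) => x y.
by rewrite exprS.
Qed.

Lemma schur_stable_sum (I : Type) (s : seq I) (D : pred I) (M_ : I -> X -> X -> C) :
  (forall i, schur_stable (M_ i)) ->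
  schur_stable (fun x y => \sum_(i <- s | D i) M_ i x y).
Proof.
move=> hM P hP; elim: s => [|i s IH].
  by apply: psd_ext psd0 => x y; rewrite big_nil mul0r.
case: (boolP (D i)) => Di; last first.
  by apply: psd_ext IH => x y; rewrite big_cons (negPf Di).
by apply: psd_ext (psdD (hM i _ hP) IH) => x y; rewrite big_cons Di mulrDl.
Qed.

Lemma schur_stable_tends (M_ : nat -> X -> X -> C) M :
  (forall x y, tends (fun n => M_ n x y) (M x y)) ->
  (forall n, schur_stable (M_ n)) -> schur_stable M.
Proof.
move=> hM hs P hP.
apply: (@psd_tends (fun n x y => M_ n x y * P x y)) => [x y|n].
  by apply: tendsM => //; exact: tends_cst.
exact: hs.
Qed.

End SchurStable.

(** * Geometric series *)

Section Geometric.
Variable R : realType.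
Local Notation C := R[i].
Implicit Types q : C.

Lemma sum_expr (F : fieldType) (q : F) n : 1 - q != 0 ->
  \sum_(0 <= k < n) q ^+ k = (1 - q ^+ n) / (1 - q).
Proof.
move=> q1; elim: n => [|n IH]; first by rewrite big_nil expr0 subrr mul0r.
by rewrite big_nat_recr //= IH exprS; field.
Qed.

Lemma sum_natr_expr (F : fieldType) (q : F) n : 1 - q != 0 ->
  \sum_(0 <= k < n) k.+1%:R * q ^+ k =
  (1 - (n.+1%:R - n%:R * q) * q ^+ n) / (1 - q) ^+ 2.
Proof.
move=> q1; elim: n => [|n IH].
  by rewrite big_nil expr0 mul0r subr0 mulr1 subrr mul0r.
by rewrite big_nat_recr //= IH [q ^+ n.+1]exprS -[n.+2%:R]natr1 -[n.+1%:R]natr1; field.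
Qed.

Lemma norm_lt1_neq0 (F : numFieldType) (q : F) : `|q| < 1 -> 1 - q != 0.
Proof.
by apply: contraTneq => /eqP; rewrite subr_eq0 => /eqP <-; rewrite normr1 ltxx.
Qed.

(** This controls the factor [n] in [n * x ^+ n]: with [x = y ^+ 2], one factor
    [y ^+ n] pays for [n], since [n * y ^+ n <= \sum_(k < n) y ^+ k]. *)
Lemma natr_expr_le (y : R) n : 0 <= y -> y < 1 -> n.+1%:R * y ^+ n <= (1 - y)^-1.
Proof.
move=> y0 y1; have d0 : 0 < 1 - y by rewrite subr_gt0.
have : \sum_(0 <= k < n.+1) y ^+ n <= \sum_(0 <= k < n.+1) y ^+ k.
  apply: ler_sum_nat => k; rewrite ltnS => /andP[_ kn].
  by apply: ler_wiXn2l => //; exact: ltW.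
rewrite sum_expr ?gt_eqF // sumr_const_nat subn0 -[y ^+ n *+ _]mulr_natl => /le_trans; apply.
by rewrite ler_piMl ?invr_ge0 ?(ltW d0) // gerBl exprn_ge0.
Qed.

Lemma tends_natr_expr q : `|q| < 1 -> tends (fun n => n.+1%:R * q ^+ n) 0.
Proof.
rewrite normc_def; set x := Num.sqrt _; rewrite ltcR => x1.
have x0 : 0 <= x by exact: sqrtr_ge0.
pose y := Num.sqrt x; have y0 : 0 <= y by exact: sqrtr_ge0.
have yx : y ^+ 2 = x by rewrite sqr_sqrtr.
have y1 : y < 1 by rewrite -sqrtr1 ltr_sqrt.
apply: (@tends_dominated _ _ _ (fun n => (1 - y)^-1 * y ^+ n)) => [n|].
  rewrite subr0 normrM normrX normr_nat normc_def -/x -yx.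
  rewrite -(rmorph_nat (real_complex R)) -!rmorphXn -rmorphM lecR.
  rewrite exprAC expr2 mulrA ler_wpM2r ?exprn_ge0 //.
  exact: natr_expr_le.
rewrite -[X in _ --> X](mulr0 (1 - y)^-1); apply: cvgM; first exact: cvg_cst.
by apply: cvg_expr; rewrite ger0_norm.
Qed.

Lemma tends_expr q : `|q| < 1 -> tends (fun n => q ^+ n) 0.
Proof.
move=> q1; apply/tendsP => e e0.
have /tendsP/(_ e e0)[N hN] := tends_natr_expr q1.
exists N => n /hN; rewrite !subr0 normrM; apply: le_lt_trans.
by rewrite normr_nat ler_peMl // ler1n.
Qed.

Lemma tends_geometric q : `|q| < 1 ->
  tends (fun n => \sum_(0 <= k < n) q ^+ k) (1 - q)^-1.
Proof.
move=> q1; have q0 := norm_lt1_neq0 q1.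
apply: (@tends_ext _ (fun n => (1 - q ^+ n) / (1 - q))) => [n|].
  by rewrite sum_expr.
rewrite -[X in tends _ X]mul1r; apply: tendsM (tends_cst _).
rewrite -[X in tends _ X]subr0; apply: tendsB (tends_cst _) _.
exact: tends_expr.
Qed.

Lemma tends_geometric2 q : `|q| < 1 ->
  tends (fun n => \sum_(0 <= k < n) k.+1%:R * q ^+ k) ((1 - q) ^- 2).
Proof.
move=> q1; have q0 := norm_lt1_neq0 q1.
apply: (@tends_ext _ (fun n =>
    (1 - (n.+1%:R - n%:R * q) * q ^+ n) / (1 - q) ^+ 2)) => [n|].
  by rewrite sum_natr_expr.
rewrite -[X in tends _ X]mul1r; apply: tendsM (tends_cst _).
rewrite -[X in tends _ X]subr0; apply: tendsB (tends_cst _) _.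
have -> : (fun n => (n.+1%:R - n%:R * q) * q ^+ n) =
    (fun n => n.+1%:R * q ^+ n * (1 - q) + q ^+ n * q).
  by apply/funext => n; rewrite -natr1; ring.
rewrite -[X in tends _ X](_ : 0 * (1 - q) + 0 * q = 0); last by rewrite !mul0r addr0.
apply: tendsD; apply: tendsM (tends_cst _); first exact: tends_natr_expr.
exact: tends_expr.
Qed.

Lemma schur_stable_geometric (X : Type) (M : X -> X -> C) :
  (forall x y, `|M x y| < 1) -> schur_stable M ->
  schur_stable (fun x y => (1 - M x y)^-1).
Proof.
move=> M1 hM.
apply: (@schur_stable_tends _ _ (fun n x y => \sum_(0 <= k < n) M x y ^+ k)).
  by move=> x y; exact: tends_geometric.
by move=> n; apply: schur_stable_sum => k; exact: schur_stableX.
Qed.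

End Geometric.

(** * A discrete Carleson inequality *)

Section SchurTest.
Variable R : realType.
Implicit Types (m n k N J : nat) (v : nat -> R).

(** The Cauchy-Schwarz inequality, without square roots. *)
Lemma sqr_sum_le (I : Type) (s : seq I) (r p q : I -> R) :
  (forall i, 0 <= p i) -> (forall i, 0 <= q i) ->
  (forall i, r i ^+ 2 <= p i * q i) ->
  (\sum_(i <- s) r i) ^+ 2 <= (\sum_(i <- s) p i) * (\sum_(i <- s) q i).
Proof.
move=> p0 q0 rpq; elim: s => [|i s IH]; first by rewrite !big_nil expr0n mul0r.
rewrite !big_cons.
have P0 : 0 <= \sum_(j <- s) p j by exact: sumr_ge0.
have Q0 : 0 <= \sum_(j <- s) q j by exact: sumr_ge0.
move: (\sum_(j <- s) r j) (\sum_(j <- s) p j) (\sum_(j <- s) q j) P0 Q0 IH.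
move=> A P Q P0 Q0 APQ.
have := rpq i; move: (r i) (p i) (q i) (p0 i) (q0 i) => a p' q' p'0 q'0 apq.
have : (2 * (a * A)) ^+ 2 <= (p' * Q + P * q') ^+ 2.
  have h1 : (a * A) ^+ 2 <= (p' * q') * (P * Q).
    by rewrite exprMn ler_pM ?sqr_ge0.
  have := sqr_ge0 (p' * Q - P * q'); move: h1; rewrite !expr2; nra.
rewrite -(real_normK (num_real (2 * _))) ler_pXn2r ?nnegrE ?addr_ge0 ?mulr_ge0 //.
by move=> /ler_normlW; move: APQ apq; rewrite !expr2; nra.
Qed.

Definition rsqrt n : R := (Num.sqrt n.+1%:R)^-1.

Lemma sqrtS_gt0 n : 0 < Num.sqrt (n.+1%:R : R).
Proof. by rewrite sqrtr_gt0 ltr0n. Qed.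

Lemma sqr_sqrt_nat n : Num.sqrt (n%:R : R) ^+ 2 = n%:R.
Proof. by rewrite sqr_sqrtr ?ler0n. Qed.

Lemma rsqrt_ge0 n : 0 <= rsqrt n.
Proof. by rewrite invr_ge0 sqrtr_ge0. Qed.

Lemma rsqrt_le_telescope m :
  rsqrt m <= 2 * (Num.sqrt m.+1%:R - Num.sqrt m%:R).
Proof.
rewrite /rsqrt; have b0 := sqrtS_gt0 m.
have a0 : 0 <= Num.sqrt (m%:R : R) by exact: sqrtr_ge0.
have := sqr_sqrt_nat m.+1; have := sqr_sqrt_nat m.
move: (Num.sqrt _) (Num.sqrt _) a0 b0 => a b a0 b0 ha; rewrite -natr1 -ha => hb.
by rewrite -div1r ler_pdivrMr //; nra.
Qed.

Lemma sum_rsqrt_le n : \sum_(0 <= k < n) rsqrt k <= 2 * Num.sqrt n%:R.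
Proof.
elim: n => [|n IH]; first by rewrite big_nil sqrtr0 mulr0.
by rewrite big_nat_recr //=; have := rsqrt_le_telescope n; lra.
Qed.

(** The increment on the right is [8 * (b - a) / ((b + c) * (a + c))], and
    [b - a >= 1 / (2 * b)] because [b^2 - a^2 = 1]. *)
Lemma frac_increment (a b c : R) : 0 <= a -> a <= b -> 1 <= c -> b ^+ 2 = a ^+ 2 + 1 ->
  b^-1 / (a ^+ 2 + c ^+ 2) <= 8 / c * (b / (b + c)) - 8 / c * (a / (a + c)).
Proof.
move=> a0 ab c1 hb.
have b0 : 0 < b by rewrite lt_neqAle (le_trans a0 ab) andbT; apply/eqP; nra.
have c0 : 0 < c by lra.
have bc0 : 0 < b + c by lra.
have ac0 : 0 < a + c by lra.
have d0 : 0 < a ^+ 2 + c ^+ 2 by rewrite ltr_wpDl ?sqr_ge0 ?exprn_gt0.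
have -> : 8 / c * (b / (b + c)) - 8 / c * (a / (a + c)) =
    8 * (b - a) / ((b + c) * (a + c)).
  by field; rewrite !gt_eqF.
have h1 : (b + c) * (a + c) <= 4 * (a ^+ 2 + c ^+ 2).
  have : (b + c) * (a + c) <= (b + c) * (b + c) by rewrite ler_wpM2l ?lerD2r ?(ltW bc0).
  have := sqr_ge0 (b - c); rewrite !expr2 in hb *; nra.
have h2 : 1 <= 2 * ((b - a) * b) by rewrite !expr2 in hb; nra.
rewrite ler_pdivlMr ?mulr_gt0 // -invfM mulrC ler_pdivrMr ?mulr_gt0 //.
apply: le_trans h1 _; rewrite mulrA ler_wpM2r ?(ltW d0) //.
by move: h2; lra.
Qed.

(** The sum telescopes after a comparison with the increments of
    [x / (x + c)], for [x] the square root of the index. *)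
Lemma rsqrt_row_sum k N :
  \sum_(0 <= m < N) rsqrt m / (m + k).+1%:R <= 8 * rsqrt k.
Proof.
set c := Num.sqrt (k.+1%:R : R); have c0 : 0 < c by exact: sqrtS_gt0.
have hc : c ^+ 2 = k.+1%:R by rewrite sqr_sqrt_nat.
suff h : \sum_(0 <= m < N) rsqrt m / (m + k).+1%:R <=
    8 / c * (Num.sqrt N%:R / (Num.sqrt N%:R + c)).
  apply: le_trans h _; rewrite /rsqrt -/c ler_piMr ?divr_ge0 ?(ltW c0) //.
  have s0 : 0 <= Num.sqrt (N%:R : R) by exact: sqrtr_ge0.
  by rewrite ler_pdivrMr ?mul1r ?lerDl ?(ltW c0) // ltr_wpDl.
elim: N => [|N IH]; first by rewrite big_nil sqrtr0 mul0r mulr0.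
rewrite big_nat_recr //= addrC -lerBrDr.
apply: le_trans (_ : _ <= 8 / c * (Num.sqrt N.+1%:R / (Num.sqrt N.+1%:R + c))
  - 8 / c * (Num.sqrt N%:R / (Num.sqrt N%:R + c))) _; last by rewrite lerD2l lerN2.
rewrite /rsqrt -addnS natrD -hc -[X in X + c ^+ 2]sqr_sqrt_nat.
apply: frac_increment; first exact: sqrtr_ge0.
- by rewrite ler_wsqrtr // ler_nat.
- by rewrite -sqrtr1 ler_wsqrtr // ler1n.
- by rewrite !sqr_sqrt_nat natr1.
Qed.

(** For [a, b > 0] one has [sqrt (a^2 + b^2) <= a + b], that is
    [1 / (a b) <= (1 / a + 1 / b) / sqrt (a^2 + b^2)]; here [a^2 + b^2 = n + 2]. *)
Lemma rsqrt_convolution n : \sum_(0 <= k < n.+1) rsqrt k * rsqrt (n - k) <= 4.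
Proof.
set s := Num.sqrt (n.+2%:R : R); have s0 : 0 < s by exact: sqrtS_gt0.
have hs : s ^+ 2 = n.+2%:R by rewrite sqr_sqrt_nat.
have h k : (k <= n)%N -> rsqrt k * rsqrt (n - k) <= s^-1 * (rsqrt k + rsqrt (n - k)).
  move=> kn; rewrite /rsqrt.
  have := sqr_sqrt_nat k.+1; have := sqr_sqrt_nat (n - k).+1.
  have := sqrtS_gt0 k; have := sqrtS_gt0 (n - k).
  set b := Num.sqrt _; set a := Num.sqrt _ => b0 a0 hb ha.
  have hab : s ^+ 2 = a ^+ 2 + b ^+ 2.
    by rewrite ha hb hs -natrD addSn addnS subnKC.
  have sab : s <= a + b.
    rewrite -(@ler_pXn2r _ 2) ?nnegrE ?addr_ge0 ?(ltW s0) ?(ltW a0) ?(ltW b0) //.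
    by rewrite hab sqrrD; have := mulr_gt0 a0 b0; lra.
  have -> : a^-1 + b^-1 = (a + b) * (a^-1 * b^-1) by field; rewrite !gt_eqF.
  rewrite mulrA ler_peMl ?mulr_ge0 ?invr_ge0 ?(ltW a0) ?(ltW b0) //.
  by rewrite mulrC ler_pdivlMr ?mul1r.
have {h} : \sum_(0 <= k < n.+1) rsqrt k * rsqrt (n - k) <=
    \sum_(0 <= k < n.+1) s^-1 * (rsqrt k + rsqrt (n - k)).
  by apply: ler_sum_nat => k; rewrite ltnS => /andP[_ /h].
move=> /le_trans; apply.
rewrite -mulr_sumr big_split /= [X in _ + X]big_nat_rev /= add0n.
under [X in _ + X]eq_big_nat => k /andP[_ kn] do rewrite subSS (subKn (_ : k <= n)%N) //.
rewrite mulrC ler_pdivrMr //.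
have := sum_rsqrt_le n.+1.
have : Num.sqrt (n.+1%:R : R) <= s by rewrite ler_wsqrtr // ler_nat.
lra.
Qed.

(** Schur's test with weights [rsqrt], for the operator which multiplies by
    [\sum_m rsqrt m * X ^ m], a function of the size of [(1 - X)^(-1/2)]. *)
Lemma rsqrt_carleson v N :
  \sum_(0 <= k < N) (\sum_(0 <= m < N) rsqrt m * v (m + k)%N) ^+ 2 <=
  32 * \sum_(0 <= n < N + N) n.+1%:R * v n ^+ 2.
Proof.
pose F n := n.+1%:R * v n ^+ 2.
have F0 n : 0 <= F n by rewrite mulr_ge0 ?sqr_ge0.
have step1 k : (\sum_(0 <= m < N) rsqrt m * v (m + k)%N) ^+ 2 <=
    8 * rsqrt k * \sum_(0 <= m < N) rsqrt m * F (m + k)%N.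
  apply: le_trans (_ : _ <= (\sum_(0 <= m < N) rsqrt m / (m + k).+1%:R) *
      \sum_(0 <= m < N) rsqrt m * F (m + k)%N) _.
    apply: sqr_sum_le => m; [by rewrite divr_ge0 ?rsqrt_ge0|by rewrite mulr_ge0 ?rsqrt_ge0|].
    have : (m + k).+1%:R != 0 :> R by rewrite pnatr_eq0.
    rewrite /F le_eqVlt => d; apply/orP; left; apply/eqP.
    by move: (_.+1%:R) d => t d; field.
  rewrite ler_wpM2r ?rsqrt_row_sum //.
  by apply: sumr_ge0 => m _; rewrite mulr_ge0 ?rsqrt_ge0.
have step2 k : (k < N)%N -> \sum_(0 <= m < N) rsqrt m * F (m + k)%N <=
    \sum_(0 <= n < N + N) (if (k <= n)%N then rsqrt (n - k) * F n else 0).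
  move=> kN; rewrite -[X in \sum_(0 <= m < X) _](addnK k).
  have -> : \sum_(0 <= m < N + k - k) rsqrt m * F (m + k)%N =
      \sum_(0 + k <= n < N + k) rsqrt (n - k) * F n.
    by rewrite big_addn; apply: eq_bigr => m _; rewrite addnK.
  rewrite add0n (big_nat_widenl _ 0) //.
  rewrite (big_nat_widen _ _ (N + N)) ?leq_add2l ?(ltnW kN) // big_mkcond.
  apply: ler_sum => n _; case: (k <= n)%N => //=; case: ifP => // _.
  by rewrite mulr_ge0 ?rsqrt_ge0.
apply: le_trans (_ : _ <= \sum_(0 <= k < N) \sum_(0 <= n < N + N)
    8 * F n * (if (k <= n)%N then rsqrt k * rsqrt (n - k) else 0)) _.
  apply: ler_sum_nat => k /andP[_ kN]; apply: le_trans (step1 k) _.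
  apply: le_trans (ler_wpM2l _ (step2 k kN)) _; first by rewrite mulr_ge0 ?rsqrt_ge0.
  rewrite mulr_sumr; apply: ler_sum => n _; case: ifP => _; last by rewrite !mulr0.
  by rewrite le_eqVlt; apply/orP; left; apply/eqP; ring.
rewrite exchange_big /= mulr_sumr; apply: ler_sum => n _.
rewrite -mulr_sumr -/(F n).
have -> : 32 * F n = 8 * F n * 4 by ring.
rewrite ler_wpM2l ?(mulr_ge0 _ (F0 n)) //; apply: le_trans (rsqrt_convolution n).
rewrite (big_nat_widen _ N (N + n.+1)) ?leq_addr //.
rewrite [leRHS](big_nat_widen _ n.+1 (N + n.+1)) ?leq_addl //.
rewrite big_mkcond [leRHS]big_mkcond; apply: ler_sum => k _ /=.
rewrite ltnS; case: (k < N)%N; case: (k <= n)%N => //.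
by rewrite mulr_ge0 ?rsqrt_ge0.
Qed.

(** The coefficients of [\sum_(j < J) 8^-j / (1 - r_j * X)^2] with
    [r_j = 1 - 4^-j], a function of the size of [(1 - X)^(-1/2)]. *)
Definition dyadic_coef J n : R :=
  \sum_(0 <= j < J) (8 ^+ j)^-1 * (n.+1%:R * (1 - (4 ^+ j)^-1) ^+ n).

Lemma expr4_ge1 j : 1 <= 4 ^+ j :> R.
Proof. by rewrite exprn_ege1 // ler1n. Qed.

Lemma radius_ge0 j : 0 <= 1 - (4 ^+ j)^-1 :> R.
Proof.
by rewrite subr_ge0 invf_le1 ?expr4_ge1 // (lt_le_trans ltr01) // expr4_ge1.
Qed.

Lemma dyadic_coef_ge0 J n : 0 <= dyadic_coef J n.
Proof.
apply: sumr_ge0 => j _; rewrite mulr_ge0 ?invr_ge0 ?exprn_ge0 ?ler0n //.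
by rewrite mulr_ge0 // exprn_ge0 // radius_ge0.
Qed.

(** Bernoulli's inequality, used for half of the exponent and then squared. *)
Lemma expr_decay (x : R) n : 0 <= x -> x <= 1 ->
  (1 - x) ^+ n * (1 + n./2%:R * x) ^+ 2 <= 1.
Proof.
move=> x0 x1; have y0 : 0 <= 1 - x by rewrite subr_ge0.
have bern m : (1 - x) ^+ m * (1 + m%:R * x) <= 1.
  elim: m => [|m IH]; first by rewrite expr0 mul1r mul0r addr0.
  have e0 : 0 <= (1 - x) ^+ m by exact: exprn_ge0.
  apply: le_trans IH; rewrite exprSr -mulrA ler_wpM2l // -natr1.
  have m0 : 0 <= m%:R :> R by exact: ler0n.
  have : 0 <= (m%:R + 1) * x ^+ 2 by rewrite mulr_ge0 ?sqr_ge0 ?addr_ge0.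
  by rewrite expr2; lra.
have b0 : 0 <= 1 + n./2%:R * x by rewrite addr_ge0 ?mulr_ge0 ?ler0n.
have -> : (1 - x) ^+ n = (1 - x) ^+ odd n * ((1 - x) ^+ n./2) ^+ 2.
  by rewrite -exprM muln2 -exprD odd_double_half.
rewrite -mulrA -exprMn mulr_ile1 ?exprn_ge0 ?mulr_ge0 ?exprn_ge0 //.
  by rewrite exprn_ile1 // gerBl.
by rewrite exprn_ile1 ?bern // mulr_ge0 ?exprn_ge0.
Qed.

Definition saturation (y : R) : R := y / (1 + y).

(** With [y = sqrt (n+1) / 2^j] the left-hand side is at most a constant times
    [min (y^3) (1 / y)], hence at most a constant times the difference of
    [y / (1 + y)] at [y] and [y / 2]. *)
Lemma dyadic_term_le j n :
  (8 ^+ j)^-1 * (n.+1%:R * (1 - (4 ^+ j)^-1) ^+ n) <=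
  24 * rsqrt n * (saturation (Num.sqrt n.+1%:R / 2 ^+ j) -
                  saturation (Num.sqrt n.+1%:R / 2 ^+ j.+1)).
Proof.
set s := Num.sqrt (n.+1%:R : R); have s0 : 0 < s by exact: sqrtS_gt0.
set x := (4 ^+ j)^-1; set y := s / 2 ^+ j.
have p0 : 0 < 2 ^+ j :> R by rewrite exprn_gt0.
have y0 : 0 < y by rewrite divr_gt0.
have x0 : 0 <= x by rewrite invr_ge0 (le_trans ler01) ?expr4_ge1.
have x1 : x <= 1 by rewrite -subr_ge0 radius_ge0.
have E4 : 4 ^+ j = (2 ^+ j) ^+ 2 :> R by rewrite exprAC -[2 ^+ _]natrX.
have E8 : 8 ^+ j = (2 ^+ j) ^+ 3 :> R by rewrite exprAC -[2 ^+ _]natrX.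
have hs : s ^+ 2 = n.+1%:R by rewrite sqr_sqrt_nat.
have -> : s / 2 ^+ j.+1 = y / 2 by rewrite exprS /y; field; rewrite gt_eqF.
have hy : y ^+ 2 = n.+1%:R * x by rewrite -hs /x E4 /y; field; rewrite gt_eqF.
have -> : (8 ^+ j)^-1 * (n.+1%:R * (1 - x) ^+ n) = s^-1 * y * (y ^+ 2 * (1 - x) ^+ n).
  by rewrite -hs E8 /y; field; rewrite !gt_eqF.
have -> : 24 * rsqrt n * (saturation y - saturation (y / 2)) =
    s^-1 * y * (12 / ((1 + y) * (1 + y / 2))).
  by rewrite /saturation /rsqrt -/s; field; rewrite !gt_eqF //; lra.
rewrite ler_wpM2l ?mulr_ge0 ?invr_ge0 ?(ltW s0) ?(ltW y0) //.
rewrite ler_pdivlMr; last by rewrite mulr_gt0 //; lra.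
have := expr_decay n x0 x1; set D := 1 + n./2%:R * x.
have D1 : 1 <= D by rewrite lerDl mulr_ge0.
have e0 : 0 <= (1 - x) ^+ n by rewrite exprn_ge0 // subr_ge0.
have hD : y ^+ 2 <= 2 * D.
  have hn : (n.+1 <= n./2.*2.+2)%N by rewrite -{1}(odd_double_half n); case: (odd n).
  have : n.+1%:R * x <= n./2.*2.+2%:R * x by rewrite ler_wpM2r // ler_nat.
  by rewrite hy /D -!natr1 -muln2 natrM; lra.
move: e0; move: ((1 - x) ^+ n) => e e0 eD.
have h1 : (1 + y) * (1 + y / 2) <= 6 * D.
    have := sqr_ge0 (1 - y); move: hD; rewrite !expr2. nra.
have h2 : y ^+ 2 * ((1 + y) * (1 + y / 2)) <= 2 * D * (6 * D).
  by rewrite ler_pM ?sqr_ge0 // mulr_ge0; lra.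
apply: le_trans (_ : _ <= e * (2 * D * (6 * D))) _.
  by rewrite mulrAC mulrC ler_wpM2l.
by move: eD; rewrite expr2; lra.
Qed.

Lemma dyadic_coef_le J n : dyadic_coef J n <= 24 * rsqrt n.
Proof.
set s := Num.sqrt (n.+1%:R : R); have s0 : 0 < s by exact: sqrtS_gt0.
have yj j : 0 <= s / 2 ^+ j by rewrite divr_ge0 ?(ltW s0) ?exprn_ge0.
suff h : dyadic_coef J n <= 24 * rsqrt n * (saturation s - saturation (s / 2 ^+ J)).
  apply: le_trans h _; rewrite ler_piMr ?mulr_ge0 ?rsqrt_ge0 //.
  have G1 : saturation s <= 1 by rewrite /saturation ler_pdivrMr ?mul1r ?lerDr //; lra.
  have : 0 <= saturation (s / 2 ^+ J) by rewrite divr_ge0 ?addr_ge0.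
  lra.
elim: J => [|J IH]; first by rewrite /dyadic_coef big_nil expr0 divr1 subrr mulr0.
rewrite /dyadic_coef big_nat_recr //= -/(dyadic_coef J n).
have := dyadic_term_le J n; rewrite -/s.
by move: IH; set A := 24 * rsqrt n; rewrite !mulrBr; lra.
Qed.

End SchurTest.

(** * Positivity of the Carleson kernel *)

Section CarlesonKernel.
Variables (R : realType) (X : Type) (z : X -> R[i]).
Local Notation C := R[i].
Implicit Types (P Q : X -> X -> C) (c : seq (C * X)) (g : X -> C) (J N : nat).

Lemma normC_real (w : C) : `|w| = (complex.Re `|w|)%:C%C.
Proof. by rewrite normc_def. Qed.

Lemma quad_rank1 g c :
  quad (fun x y => g x * (g y)^*) c = `|\sum_(p <- c) (p.1)^* * g p.2| ^+ 2.
Proof.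
rewrite normCK /quad mulrC rmorph_sum /= mulr_suml; apply: eq_bigr => p _.
rewrite mulr_sumr; apply: eq_bigr => q _.
by rewrite rmorphM /= conjCK; ring.
Qed.

Lemma quad_suml (I : Type) (s : seq I) (a : I -> C) (P_ : I -> X -> X -> C) c :
  quad (fun x y => \sum_(i <- s) a i * P_ i x y) c =
  \sum_(i <- s) a i * quad (P_ i) c.
Proof.
rewrite /quad; under [RHS]eq_bigr do rewrite mulr_sumr.
rewrite [RHS]exchange_big; apply: eq_bigr => p _ /=.
under [RHS]eq_bigr do rewrite mulr_sumr.
rewrite [RHS]exchange_big; apply: eq_bigr => q _ /=.
by rewrite mulr_sumr; apply: eq_bigr => i _; ring.
Qed.

Lemma quadB P Q c : quad (fun x y => P x y - Q x y) c = quad P c - quad Q c.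
Proof.
rewrite /quad -sumrB; apply: eq_bigr => p _; rewrite -sumrB.
by apply: eq_bigr => q _; rewrite mulrBr.
Qed.

Definition carleson_const : R := 24 ^+ 2 * 32.

Lemma dyadic_carleson (u : nat -> C) J N :
  \sum_(0 <= k < N)
    `|\sum_(0 <= m < N) (dyadic_coef R J m)%:C%C * u (m + k)%N| ^+ 2 <=
  carleson_const%:C%C * \sum_(0 <= n < N + N) n.+1%:R * `|u n| ^+ 2.
Proof.
pose v n := complex.Re `|u n|.
have vE n : `|u n| = (v n)%:C%C by exact: normC_real.
have v0 n : 0 <= v n by rewrite -ler0c -vE.
have -> : \sum_(0 <= n < N + N) n.+1%:R * `|u n| ^+ 2 =
    (\sum_(0 <= n < N + N) n.+1%:R * v n ^+ 2)%:C%C.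
  rewrite rmorph_sum; apply: eq_bigr => n _.
  by rewrite vE rmorphM rmorphXn /= rmorph_nat.
apply: le_trans (_ : _ <= (24 ^+ 2 *
    \sum_(0 <= k < N) (\sum_(0 <= m < N) rsqrt R m * v (m + k)%N) ^+ 2)%:C%C) _; last first.
  rewrite -rmorphM lecR /carleson_const -[leRHS]mulrA ler_wpM2l ?exprn_ge0 //.
  exact: rsqrt_carleson.
rewrite mulr_sumr rmorph_sum; apply: ler_sum => k _.
rewrite -exprMn rmorphXn /= ler_pXn2r ?nnegrE ?normr_ge0 //; last first.
  by rewrite ler0c mulr_ge0 //; apply: sumr_ge0 => m _; rewrite mulr_ge0 ?rsqrt_ge0.
apply: le_trans (ler_norm_sum _ _ _) _.
rewrite mulr_sumr rmorph_sum; apply: ler_sum => m _.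
rewrite normrM vE ger0_norm ?ler0c ?dyadic_coef_ge0 // -rmorphM lecR mulrA.
by rewrite ler_wpM2r // dyadic_coef_le.
Qed.

Definition dyadic_fun J (w : C) : C :=
  \sum_(0 <= j < J) ((8 ^+ j)^-1)%:C%C * (1 - (1 - (4 ^+ j)^-1)%:C%C * w) ^- 2.

Lemma radius_lt1 j : 1 - (4 ^+ j)^-1 < 1 :> R.
Proof. by rewrite ltrBlDr ltrDl invr_gt0 exprn_gt0. Qed.

Lemma norm_radiusM_lt1 (w : C) j : `|w| < 1 -> `|(1 - (4 ^+ j)^-1)%:C%C * w| < 1.
Proof.
move=> w1; rewrite normrM ger0_norm ?ler0c ?radius_ge0 //.
by rewrite (le_lt_trans _ w1) // ler_piMl // lecR ltW // radius_lt1.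
Qed.

Lemma tends_dyadic_fun J (w : C) : `|w| < 1 ->
  tends (fun N => \sum_(0 <= m < N) (dyadic_coef R J m)%:C%C * w ^+ m) (dyadic_fun J w).
Proof.
move=> w1; apply: (@tends_ext _ (fun N => \sum_(0 <= j < J) ((8 ^+ j)^-1)%:C%C *
    \sum_(0 <= m < N) m.+1%:R * ((1 - (4 ^+ j)^-1)%:C%C * w) ^+ m)) => [N|].
  under eq_bigr do rewrite mulr_sumr.
  rewrite exchange_big; apply: eq_bigr => m _ /=.
  rewrite rmorph_sum mulr_suml; apply: eq_bigr => j _.
  by rewrite exprMn 2!rmorphM rmorphXn rmorph_nat /= !mulrA.
apply: tends_sum => j; apply: tendsM; first exact: tends_cst.
exact: tends_geometric2 (norm_radiusM_lt1 _ w1).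
Qed.

Hypothesis z_lt1 : forall x, `|z x| < 1.

Lemma szego_lt1 x y : `|z x * (z y)^*| < 1.
Proof. by rewrite normrM norm_conjC mulr_ilt1. Qed.

(** The kernels [(1 - s)^-1] and [(1 - s)^-2] are those of the Hardy and the
    Bergman space, so this is the boundedness of multiplication by [dyadic_fun J]
    between them, uniformly in [J]. Truncating all the power series at the same
    order leaves the finite inequality [dyadic_carleson]. *)
Lemma psd_carleson J : psd (fun x y =>
  carleson_const%:C%C * (1 - z x * (z y)^*) ^- 2 -
  (1 - z x * (z y)^*)^-1 * (dyadic_fun J (z x) * (dyadic_fun J (z y))^*)).
Proof.
pose psi N w : C := \sum_(0 <= m < N) (dyadic_coef R J m)%:C%C * w ^+ m.
apply: (@psd_tends _ _ (fun N x y =>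
    carleson_const%:C%C * \sum_(0 <= n < N + N) n.+1%:R * (z x * (z y)^*) ^+ n -
    (\sum_(0 <= k < N) (z x * (z y)^*) ^+ k) * (psi N (z x) * (psi N (z y))^*))).
  move=> x y; apply: tendsB; apply: tendsM.
  - exact: tends_cst.
  - apply/tendsP => e e0.
    have /tendsP/(_ e e0)[N hN] := tends_geometric2 (szego_lt1 x y).
    by exists N => n Nn; apply: hN; rewrite (leq_trans Nn) ?leq_addr.
  - exact: tends_geometric (szego_lt1 x y).
  apply: tendsM; first exact: tends_dyadic_fun.
  by apply: tends_conj; exact: tends_dyadic_fun.
move=> N c; pose u n := \sum_(p <- c) (p.1)^* * z p.2 ^+ n.
have qu n : quad (fun x y => (z x * (z y)^*) ^+ n) c = `|u n| ^+ 2.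
  rewrite -(quad_rank1 (fun x => z x ^+ n)); congr quad.
  by apply/funext => x; apply/funext => y; rewrite rmorphXn exprMn.
rewrite quadB subr_ge0.
have -> : (fun x y => carleson_const%:C%C *
      \sum_(0 <= n < N + N) n.+1%:R * (z x * (z y)^*) ^+ n) =
    fun x y => \sum_(0 <= n < N + N)
      (carleson_const%:C%C * n.+1%:R) * (z x * (z y)^*) ^+ n.
  apply/funext => x; apply/funext => y; rewrite mulr_sumr.
  by apply: eq_bigr => n _; rewrite mulrA.
have -> : (fun x y => (\sum_(0 <= k < N) (z x * (z y)^*) ^+ k) *
      (psi N (z x) * (psi N (z y))^*)) =
    fun x y => \sum_(0 <= k < N) 1 * ((z x ^+ k * psi N (z x)) * (z y ^+ k * psi N (z y))^*).
  apply/funext => x; apply/funext => y; rewrite mulr_suml.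
  by apply: eq_bigr => k _; rewrite exprMn !rmorphM rmorphXn /=; ring.
rewrite !quad_suml.
under eq_bigr do rewrite mul1r (quad_rank1 (fun x => z x ^+ _ * psi N (z x))).
under [leRHS]eq_bigr do rewrite qu -mulrA.
rewrite -mulr_sumr; apply: le_trans (dyadic_carleson u J N).
rewrite le_eqVlt; apply/orP; left; apply/eqP; apply: eq_bigr => k _.
congr (`|_| ^+ 2); under [RHS]eq_bigr do rewrite mulr_sumr.
rewrite exchange_big; apply: eq_bigr => p _ /=.
rewrite mulr_sumr mulr_sumr; apply: eq_bigr => m _.
by rewrite exprD; ring.
Qed.

End CarlesonKernel.

(** * Multipliers of the Drury-Arveson space *)

Section Ball.
Variables (R : realType) (d : nat).
Local Notation C := R[i].
Local Notation ball := (unit_ball R d).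
Local Notation K := (@drury_arveson_kernel R d).
Implicit Types x y : ball.

Definition coordinate (i : 'I_d) x : C := sval x 0 i.

Lemma dotmx_sum (u v : 'rV[C]_d) : dotmx u v = \sum_i u 0 i * (v 0 i)^*.
Proof. by rewrite dotmxE mxE; apply: eq_bigr => i _; rewrite !mxE. Qed.

Lemma norm_sqr_lt1 (w : C) : `|w| ^+ 2 < 1 -> `|w| < 1.
Proof. by rewrite -(@ltr_pXn2r _ 2 _ `|w| 1) ?nnegrE ?normr_ge0 // expr1n. Qed.

Lemma norm_coord_lt1 i x : `|coordinate i x| < 1.
Proof.
apply: norm_sqr_lt1; apply: le_lt_trans (svalP x).
rewrite dotmx_sum (bigD1 i) //= -normCK lerDl.
by apply: sumr_ge0 => j _; exact: mul_conjC_ge0.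
Qed.

Lemma norm_dotmx_lt1 x y : `|dotmx (sval x) (sval y)| < 1.
Proof.
apply: norm_sqr_lt1; apply: le_lt_trans (CauchySchwarz _ _ _) _.
by apply: le_lt_trans (svalP x); rewrite ler_piMr ?(ltW (svalP y)) // dnorm_ge0.
Qed.

Lemma kernelE x y : K x y = (1 - dotmx (sval x) (sval y))^-1.
Proof. by rewrite /drury_arveson_kernel mul1r. Qed.

Definition coord_kernel (D : pred 'I_d) x y : C :=
  \sum_(i | D i) coordinate i x * (coordinate i y)^*.

Lemma schur_stable_coord_kernel D : schur_stable (coord_kernel D).
Proof.
apply: (@schur_stable_sum _ _ _ _ _ (fun i x y => coordinate i x * (coordinate i y)^*)) => i.
exact: schur_stable_rank1.
Qed.

Lemma schur_stable_kernel : schur_stable K.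
Proof.
move=> P hP; apply: (@psd_ext _ _ (fun x y => (1 - coord_kernel predT x y)^-1 * P x y)).
  by move=> x y; rewrite kernelE dotmx_sum.
apply: schur_stable_geometric hP; last exact: schur_stable_coord_kernel.
by move=> x y; rewrite /coord_kernel -dotmx_sum norm_dotmx_lt1.
Qed.

Variables (i0 i1 : 'I_d).
Hypothesis i01 : i1 != i0.

Definition dyadic_multiplier J x : C := coordinate i1 x * dyadic_fun J (coordinate i0 x).

(** Write [s] for the part of [<x, y>] coming from the coordinate [i0] and [t]
    for the rest. The factor [coordinate i1] supplies the extra power of
    [(1 - s)^-1] by which the Bergman kernel exceeds the Hardy kernel. *)
Lemma psd_dyadic_multiplier J : psd (fun x y =>
  ((carleson_const R)%:C%C - dyadic_multiplier J x * (dyadic_multiplier J y)^*) * K x y).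
Proof.
set B : C := (carleson_const R)%:C%C.
pose s x y := coordinate i0 x * (coordinate i0 y)^*.
pose S x y := (1 - s x y)^-1.
pose t1 x y := coordinate i1 x * (coordinate i1 y)^*.
pose t' := coord_kernel (fun i => (i != i0) && (i != i1)).
pose L x y := B * (1 - s x y) ^- 2 -
  S x y * (dyadic_fun J (coordinate i0 x) * (dyadic_fun J (coordinate i0 y))^*).
have sB : schur_stable (fun _ _ : ball => B).
  by apply: schur_stable_cst; rewrite mulr_ge0 ?exprn_ge0.
have s1 : schur_stable (fun _ _ : ball => 1 : C).
  exact: (@schur_stable_cst _ _ 1 ler01).
have sS : schur_stable S.
  apply: schur_stable_geometric; last exact: schur_stable_rank1.
  by move=> x y; apply: szego_lt1; exact: norm_coord_lt1.
have st1 : schur_stable t1 by exact: schur_stable_rank1.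
have st' : schur_stable t' by exact: schur_stable_coord_kernel.
have sK := schur_stable_kernel.
have psdL : psd L by apply: psd_carleson; exact: norm_coord_lt1.
have st : schur_stable (fun x y => t1 x y + t' x y) by exact: schur_stableD.
have part1 : psd (fun x y => B * S x y).
  exact/schur_stable_psd/schur_stableM.
have part2 : psd (fun x y => B * S x y * (t' x y * K x y)).
  by apply: schur_stable_psd; apply: schur_stableM; exact: schur_stableM.
have part3 : psd (fun x y => t1 x y * (1 + (t1 x y + t' x y) * K x y) * L x y).
  suff : schur_stable (fun x y => t1 x y * (1 + (t1 x y + t' x y) * K x y)) by apply.
  apply: schur_stableM st1 _; apply: schur_stableD s1 _; exact: schur_stableM.
apply: psd_ext (psdD (psdD part1 part2) part3) => x y.
have eK : K x y = (1 - s x y - (t1 x y + t' x y))^-1.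
  rewrite kernelE dotmx_sum (bigD1 i0) //= (bigD1 i1) //= opprD addrA.
  by congr (_ - (_ + _))^-1.
have nK : 1 - s x y - (t1 x y + t' x y) != 0.
  have := norm_lt1_neq0 (norm_dotmx_lt1 x y).
  by rewrite -invr_eq0 -kernelE eK invr_eq0.
have ns : 1 - s x y != 0.
  by apply/norm_lt1_neq0/szego_lt1; exact: norm_coord_lt1.
rewrite eK /L /S /dyadic_multiplier rmorphM.
have -> : coordinate i1 x * dyadic_fun J (coordinate i0 x) *
    ((coordinate i1 y)^* * (dyadic_fun J (coordinate i0 y))^*) =
    t1 x y * (dyadic_fun J (coordinate i0 x) * (dyadic_fun J (coordinate i0 y))^*).
  by rewrite /t1; ring.
move: (_ * (dyadic_fun _ _)^*) (t1 x y) (t' x y) (s x y) nK ns => p a b c nK ns.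
by field; rewrite nK ns.
Qed.

End Ball.

(** * Derivatives of the reproducing kernel *)

Section DerivativeKernel.
Variables (R : realType) (d : nat) (H : drury_arveson R d) (i0 i1 : 'I_d).
Hypothesis i01 : i1 != i0.
Local Notation C := R[i].
Local Notation ball := (unit_ball R d).
Local Notation K := (@drury_arveson_kernel R d).
Local Notation ip := (rkhs_ip H).
Local Notation S := (rkhs_set H).
Implicit Types (r e : R) (w x y : ball) (f g : ball -> C).

Definition point_row r e : 'rV[C]_d :=
  \row_i (if i == i0 then r%:C%C else if i == i1 then e%:C%C else 0).

Lemma dotmx_point_row (u : 'rV[C]_d) r e :
  dotmx u (point_row r e) = u 0 i0 * r%:C%C + u 0 i1 * e%:C%C.
Proof.
rewrite dotmx_sum (bigD1 i0) //= (bigD1 i1) //= big1 => [|i /andP[n0 n1]].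
  by rewrite !mxE !eqxx (negPf i01) addr0 !conj_real.
by rewrite !mxE (negPf n0) (negPf n1) rmorph0 mulr0.
Qed.

Lemma dotmx_row0_lt1 : dotmx (0 : 'rV[C]_d) 0 < 1.
Proof. by rewrite dotmx_sum big1 ?ltr01 // => i _; rewrite mxE mul0r. Qed.

Lemma exists_point r e :
  exists x : ball, r ^+ 2 + e ^+ 2 < 1 -> sval x = point_row r e.
Proof.
have [re|nre] := pselect (r ^+ 2 + e ^+ 2 < 1); last first.
  by exists (exist (fun z : 'rV[C]_d => dotmx z z < 1) _ dotmx_row0_lt1) => /nre.
suff h : dotmx (point_row r e) (point_row r e) < 1.
  by exists (exist (fun z : 'rV[C]_d => dotmx z z < 1) _ h).
rewrite dotmx_point_row !mxE !eqxx (negPf i01).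
by rewrite -!rmorphM -rmorphD ltcR.
Qed.

(** The value is arbitrary when [point_row r e] is not in the ball; this avoids
    proof arguments in the sequences of points below. *)
Definition slice_point r e : ball := projT1 (cid (exists_point r e)).

Lemma sval_point r e : r ^+ 2 + e ^+ 2 < 1 -> sval (slice_point r e) = point_row r e.
Proof. exact: projT2 (cid (exists_point r e)). Qed.

Lemma coord_point0 r e : r ^+ 2 + e ^+ 2 < 1 -> coordinate i0 (slice_point r e) = r%:C%C.
Proof. by move=> re; rewrite /coordinate sval_point // mxE eqxx. Qed.

Lemma coord_point1 r e : r ^+ 2 + e ^+ 2 < 1 -> coordinate i1 (slice_point r e) = e%:C%C.
Proof. by move=> re; rewrite /coordinate sval_point // mxE (negPf i01) eqxx. Qed.

Lemma kernel_point w r e : r ^+ 2 + e ^+ 2 < 1 ->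
  K w (slice_point r e) = (1 - (coordinate i0 w * r%:C%C + coordinate i1 w * e%:C%C))^-1.
Proof. by move=> re; rewrite kernelE sval_point // dotmx_point_row. Qed.

Lemma kernel_points r e r' e' : r ^+ 2 + e ^+ 2 < 1 -> r' ^+ 2 + e' ^+ 2 < 1 ->
  K (slice_point r e) (slice_point r' e') = ((1 - r * r' - e * e')^-1)%:C%C.
Proof.
move=> re re'; rewrite kernel_point // coord_point0 // coord_point1 // fmorphV.
congr _^-1; apply/eqP; rewrite eq_complex /= !(mulr0, mul0r, subr0, addr0, oppr0).
by rewrite eqxx andbT opprD addrA.
Qed.

(** The increments stay below [(1 - r) / 2], which keeps the points in the ball. *)
Definition step r (n : nat) : R := (1 - r) / n.+2%:R.

Definition diff_quotient r (n : nat) f : C :=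
  (step r n)^-1%:C%C * (f (slice_point r (step r n)) - f (slice_point r 0)).

Definition derivative_kernel r w : C :=
  coordinate i1 w * (1 - r%:C%C * coordinate i0 w) ^- 2.

Section Radius.
Variable r : R.
Hypotheses (r0 : 0 <= r) (r1 : r < 1).

Lemma step_gt0 n : 0 < step r n.
Proof. by rewrite divr_gt0 ?subr_gt0. Qed.

Lemma step_le n : step r n <= (1 - r) / 2.
Proof.
by rewrite ler_wpM2l ?subr_ge0 ?(ltW r1) // lef_pV2 ?posrE // ler_nat.
Qed.

Lemma step_to0 : step r n @[n --> \oo] --> (0 : R).
Proof.
rewrite -(mulr0 (1 - r)); apply: cvgM; first exact: cvg_cst.
by have := @cvg_harmonic R; rewrite -(cvg_shiftn 1) /=; under eq_fun do rewrite addn1.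
Qed.

Lemma step_in_ball n : r ^+ 2 + step r n ^+ 2 < 1.
Proof.
have [p0 p1] := (r0, r1); have h1 : 0 < (1 - r) * (1 + r) by apply: mulr_gt0; lra.
have h2 : 0 <= (1 - r) * r by apply: mulr_ge0; lra.
have h : step r n ^+ 2 <= ((1 - r) / 2) ^+ 2.
  have e0 := ltW (step_gt0 n).
  by rewrite ler_pXn2r ?nnegrE ?step_le // (le_trans e0 (step_le n)).
by move: h h1 h2; rewrite !expr2; lra.
Qed.

Lemma center_in_ball : r ^+ 2 + 0 ^+ 2 < 1.
Proof.
rewrite expr0n addr0 -[ltRHS](expr1n _ 2) ltr_pXn2r ?nnegrE //; exact: ler01.
Qed.

Definition kernel_quotient n w : C :=
  (step r n)^-1%:C%C * (K w (slice_point r (step r n)) - K w (slice_point r 0)).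

Lemma kernel_quotient_set n : S (kernel_quotient n).
Proof. by apply/rkhs_setZ/rkhs_setB; exact: rkhs_kernel. Qed.

Lemma ip_kernel_quotient n f : S f -> ip f (kernel_quotient n) = diff_quotient r n f.
Proof. exact: rkhs_ip_kernel_diff. Qed.

Lemma kernel_quotient_gram n m (A := 1 - r ^+ 2) :
  ip (kernel_quotient n) (kernel_quotient m) =
  ((A * (A - step r n * step r m))^-1)%:C%C.
Proof.
rewrite ip_kernel_quotient; last exact: kernel_quotient_set.
have [n0 m0] := (step_gt0 n, step_gt0 m).
have An : A - step r n * step r m != 0.
  have := step_in_ball n; have := step_in_ball m.
  have := sqr_ge0 (step r n - step r m).
  rewrite /A; move: (step r n) (step r m) => a b h ha hb.
  by rewrite gt_eqF // -subr_gt0 subr0; move: h ha hb; rewrite !expr2; lra.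
have A0 : A != 0 by have := center_in_ball; rewrite /A => h; rewrite gt_eqF //; lra.
rewrite /diff_quotient /kernel_quotient.
rewrite !kernel_points ?step_in_ball ?center_in_ball // !mulr0 !mul0r !subr0 -expr2 -/A.
rewrite -!rmorphB -!rmorphM -!rmorphB -!rmorphM; congr (_%:C%C).
by field; rewrite ?An ?A0 ?gt_eqF.
Qed.

(** All inner products between the quotients are values of the kernel, and they
    converge to [(1 - r^2)^-2] with an error controlled by the increments. *)
Lemma kernel_quotient_cauchy n m (b := fun n => 2 / (1 - r ^+ 2) ^+ 3 * step r n) :
  ip (fun x => kernel_quotient n x - kernel_quotient m x)
     (fun x => kernel_quotient n x - kernel_quotient m x) <= (b n + b m)%:C%C.
Proof.
have Sq := kernel_quotient_set.
have G := kernel_quotient_gram.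
rewrite (rkhs_ip_diff (Sq n) (Sq m) (G n n) (G m m) (G n m)).
rewrite lecR /b {b}; set A := 1 - r ^+ 2.
have A0 : 0 < A by have := center_in_ball; rewrite /A; lra.
have hA n' : step r n' ^+ 2 <= A / 2 /\ step r n' ^+ 2 <= step r n'.
  have [p0 p1] := (r0, r1).
  have e0 := step_gt0 n'; have := step_le n'; move: (step r n') e0 => e e0 e1.
  have h1 : e * e <= (1 - r) / 2 * 1 by apply: ler_pM; lra.
  have h2 : 0 <= r * (1 - r) by apply: mulr_ge0; lra.
  have h3 : e * e <= e * 1 by apply: ler_wpM2l; lra.
  by rewrite /A !expr2; split; lra.
have hdiag n' : (A * (A - step r n' * step r n'))^-1 <=
    (A * A)^-1 + 2 / A ^+ 3 * step r n'.
  have [h1 h2] := hA n'; rewrite -expr2.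
  have B0 : 0 < A - step r n' ^+ 2 by lra.
  have -> : (A * (A - step r n' ^+ 2))^-1 = (A * A)^-1 +
      step r n' ^+ 2 / (A ^+ 2 * (A - step r n' ^+ 2)).
    by field; rewrite !gt_eqF.
  have h3 : (A ^+ 2 * (A - step r n' ^+ 2))^-1 <= 2 / A ^+ 3.
    have -> : 2 / A ^+ 3 = (A ^+ 2 * (A / 2))^-1 by field; rewrite gt_eqF.
    rewrite lef_pV2 ?posrE ?mulr_gt0 ?exprn_gt0 ?divr_gt0 //.
    by apply: ler_wpM2l; [exact: sqr_ge0 | lra].
  rewrite lerD2l mulrC; apply: ler_pM => //; last exact: sqr_ge0.
  by rewrite invr_ge0; apply: mulr_ge0; [exact: sqr_ge0 | exact: ltW].
have hoff : (A * A)^-1 <= (A * (A - step r n * step r m))^-1.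
  have [h1 _] := hA n; have [h2 _] := hA m.
  have := sqr_ge0 (step r n - step r m).
  have := mulr_gt0 (step_gt0 n) (step_gt0 m).
  move: h1 h2; move: (step r n) (step r m) => e e'; rewrite !expr2 => h1 h2 h3 h4.
  have h5 : 0 < A - e * e' by lra.
  rewrite lef_pV2 ?posrE ?(mulr_gt0 A0) //; apply: ler_wpM2l; lra.
by have := hdiag n; have := hdiag m; lra.
Qed.

(** The difference quotients of the kernel converge in norm, so their limit
    reproduces the limit of the difference quotients of [f]. *)
Lemma derivative_kernel_reproducing :
  S (derivative_kernel r) /\
  (forall f, S f -> tends (fun n => diff_quotient r n f) (ip f (derivative_kernel r))).
Proof.
pose b n := 2 / (1 - r ^+ 2) ^+ 3 * step r n.
have b0 : b n @[n --> \oo] --> (0 : R).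
  rewrite -(mulr0 (2 / (1 - r ^+ 2) ^+ 3)); apply: cvgM; first exact: cvg_cst.
  exact: step_to0.
have [f Sf hf] := rkhs_cvg kernel_quotient_set b0 kernel_quotient_cauchy.
suff E : derivative_kernel r = f.
  rewrite E; split=> [|g Sg]; first exact: Sf.
  have h := tends_conj (hf g Sg); rewrite -(rkhs_ip_conj Sf Sg) in h.
  apply: tends_ext h => n.
  by rewrite -ip_kernel_quotient // -(rkhs_ip_conj (kernel_quotient_set n) Sg).
apply/funext => w.
have fw : tends (fun n => kernel_quotient n w) (f w).
  rewrite -(rkhs_reproducing w Sf); apply: tends_ext (hf _ (rkhs_kernel H w)) => n.
  by rewrite (rkhs_reproducing w (kernel_quotient_set n)).
apply: tends_unique fw => {f Sf hf}.
set z0 := coordinate i0 w; set z1 := coordinate i1 w.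
have n0 : 1 - r%:C%C * z0 != 0.
  apply: norm_lt1_neq0; rewrite normrM ger0_norm ?ler0c //.
  rewrite (le_lt_trans _ (norm_coord_lt1 i0 w)) // ler_piMl // lecR; exact: ltW.
have ne n : 1 - (z0 * r%:C%C + z1 * (step r n)%:C%C) != 0.
  rewrite -dotmx_point_row -(sval_point (step_in_ball n)).
  exact: norm_lt1_neq0 (norm_dotmx_lt1 _ _).
apply: (@tends_ext _ (fun n => z1 * ((1 - r%:C%C * z0)^-1 *
    (1 - (z0 * r%:C%C + z1 * (step r n)%:C%C))^-1))) => [n|].
  rewrite /kernel_quotient (kernel_point w (step_in_ball n)).
  rewrite (kernel_point w center_in_ball) -/z0 -/z1 rmorph0 mulr0 addr0.
  have := ne n; have : (step r n)%:C%C != 0 :> C.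
    by rewrite (inj_eq (@complexI R)) gt_eqF // step_gt0.
  rewrite fmorphV /=; move: n0; rewrite [r%:C%C * _]mulrC => {ne}.
  move: (step r n)%:C%C (z0 * r%:C%C) z1 => e a c h1 h2 h3.
  by field; rewrite h1 h2 h3.
rewrite /derivative_kernel -/z0 -/z1; apply: tendsM (tends_cst _) _.
rewrite expr2 invfM; apply: tendsM (tends_cst _) _.
apply: tendsV n0 _; apply: tendsB (tends_cst _) _.
rewrite -[X in tends _ X]addr0 [r%:C%C * z0]mulrC; apply: tendsD (tends_cst _) _.
rewrite -[X in tends _ X](mulr0 z1); apply: tendsM (tends_cst _) _.
exact: tends_real step_to0.
Qed.

End Radius.
End DerivativeKernel.

(** * The limit of the multipliers and its Sarason function *)

Section Unbounded.
Variables (R : realType) (d : nat) (H : drury_arveson R d) (i0 i1 : 'I_d).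
Hypothesis i01 : i1 != i0.
Local Notation C := R[i].
Local Notation ball := (unit_ball R d).
Local Notation K := (@drury_arveson_kernel R d).
Local Notation ip := (rkhs_ip H).
Local Notation S := (rkhs_set H).
Local Notation slice_point := (slice_point i01).
Local Notation diff_quotient := (diff_quotient i01).

Definition dyadic_radius (j : nat) : R := 1 - (4 ^+ j)^-1.
Definition dyadic_weight (j : nat) : R := (8 ^+ j)^-1.
Definition dyadic_atom (j : nat) : ball -> C := derivative_kernel i0 i1 (dyadic_radius j).

Lemma radius_range j : 0 <= dyadic_radius j /\ dyadic_radius j < 1.
Proof. by split; [exact: radius_ge0 | exact: radius_lt1]. Qed.

Lemma atom_set j : S (dyadic_atom j).
Proof.
have [r0 r1] := radius_range j.
by have [] := derivative_kernel_reproducing H i01 r0 r1.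
Qed.

Lemma tends_ip_atom j f : S f ->
  tends (fun n => diff_quotient (dyadic_radius j) n f) (ip f (dyadic_atom j)).
Proof.
have [r0 r1] := radius_range j => Sf.
by have [_] := derivative_kernel_reproducing H i01 r0 r1; apply.
Qed.

Lemma weight_gt0 j : 0 < dyadic_weight j.
Proof. by rewrite invr_gt0 exprn_gt0. Qed.

Definition atom_gram i j : R := (1 - dyadic_radius i * dyadic_radius j) ^- 2.

Lemma radiusM_lt1 i j : 0 < 1 - dyadic_radius i * dyadic_radius j.
Proof.
have [a0 a1] := radius_range i; have [b0 b1] := radius_range j.
by rewrite subr_gt0; apply: mulr_ilt1.
Qed.

Lemma atom_gram_gt0 i j : 0 < atom_gram i j.
Proof. by rewrite invr_gt0 exprn_gt0 ?radiusM_lt1. Qed.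

Lemma ip_atom i j : ip (dyadic_atom i) (dyadic_atom j) = (atom_gram i j)%:C%C.
Proof.
have [r0 r1] := radius_range j.
apply: tends_unique (tends_ip_atom (atom_set i)) _.
apply: tends_ext (tends_cst _) => n.
rewrite /diff_quotient /dyadic_atom /derivative_kernel.
have s := step_in_ball r0 r1 n; have c := center_in_ball r0 r1.
rewrite (coord_point0 i01 s) (coord_point1 i01 s) (coord_point1 i01 c) mul0r subr0.
have e0 : (step (dyadic_radius j) n)%:C%C != 0 :> C.
  by rewrite (inj_eq (@complexI R)) gt_eqF // step_gt0.
rewrite [((step _ _)^-1)%:C%C]fmorphV mulKf //.
by rewrite /atom_gram fmorphV rmorphXn rmorphB rmorphM rmorph1.
Qed.

Lemma dyadic_multiplier_sum J :
  dyadic_multiplier i0 i1 J =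
  fun x => \sum_(0 <= j < J) (dyadic_weight j)%:C%C * dyadic_atom j x.
Proof.
apply/funext => x; rewrite /dyadic_multiplier mulr_sumr; apply: eq_bigr => j _.
by rewrite /dyadic_atom /derivative_kernel /dyadic_weight mulrCA.
Qed.

Lemma dyadic_multiplier_set J : S (dyadic_multiplier i0 i1 J).
Proof.
rewrite dyadic_multiplier_sum.
exact: (@rkhs_set_sum _ _ _ H _ _ _ _ atom_set).
Qed.

Lemma ip_dyadic_multiplier J g : S g ->
  ip (dyadic_multiplier i0 i1 J) g =
  \sum_(0 <= j < J) (dyadic_weight j)%:C%C * ip (dyadic_atom j) g.
Proof.
move=> Sg; rewrite dyadic_multiplier_sum.
exact: (@rkhs_ip_suml _ _ _ H _ _ _ _ _ atom_set).
Qed.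

(** Each of [1 - r_i] and [1 - r_j] is at most [1 - r_i * r_j]. *)
Lemma atom_gram_le i j : atom_gram i j <= 4 ^+ i * 4 ^+ j.
Proof.
have p k : 0 < 4 ^+ k :> R by rewrite exprn_gt0.
have [a0 a1] := radius_range i; have [b0 b1] := radius_range j.
have h k k' : (4 ^+ k)^-1 <= 1 - dyadic_radius k * dyadic_radius k'.
  have [_ c1] := radius_range k'; have [c0 _] := radius_range k.
  by have := ler_wpM2l c0 (ltW c1); rewrite mulr1 /dyadic_radius; lra.
rewrite /atom_gram -[4 ^+ i]invrK -[4 ^+ j]invrK -invfM lef_pV2.
- rewrite expr2 ler_pM ?invr_ge0 ?(ltW (p _)) //.
  by rewrite [dyadic_radius i * _]mulrC.
- by rewrite posrE exprn_gt0 ?radiusM_lt1.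
- by rewrite posrE mulr_gt0 ?invr_gt0.
Qed.

Lemma sum_half_le m n : \sum_(m <= j < n) (2 ^+ j)^-1 <= 2 / 2 ^+ m :> R.
Proof.
have [mn|nm] := leqP m n; last first.
  by rewrite big_geq ?(ltnW nm) // divr_ge0 ?exprn_ge0.
rewrite (@telescope_sumr_eq _ m n (fun j => - (2 / 2 ^+ j))) // => [|k _].
  by rewrite opprK addrC gerBl divr_ge0 ?exprn_ge0.
by rewrite exprS; field; rewrite expf_neq0.
Qed.

Lemma weight_expr4 j : dyadic_weight j * 4 ^+ j = (2 ^+ j)^-1 :> R.
Proof.
have -> : dyadic_weight j = (2 ^+ j)^-1 * (4 ^+ j)^-1.
  by rewrite -invfM -exprMn -natrM.
by rewrite mulfVK // expf_neq0.
Qed.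

Lemma dyadic_multiplier_cauchy_le n m (b := fun n => 4 / 2 ^+ n : R) : (n <= m)%N ->
  ip (fun x => dyadic_multiplier i0 i1 m x - dyadic_multiplier i0 i1 n x)
     (fun x => dyadic_multiplier i0 i1 m x - dyadic_multiplier i0 i1 n x)
  <= (b n)%:C%C.
Proof.
move=> nm.
have -> : (fun x => dyadic_multiplier i0 i1 m x - dyadic_multiplier i0 i1 n x) =
    fun x => \sum_(n <= j < m) (dyadic_weight j)%:C%C * dyadic_atom j x.
  apply/funext => x; rewrite !dyadic_multiplier_sum (big_cat_nat _ nm) //=.
  by rewrite addrAC subrr add0r.
have Ss := @rkhs_set_sum _ _ _ H _ (index_iota n m)
  (fun j => (dyadic_weight j)%:C%C) _ atom_set.
rewrite (rkhs_ip_suml _ _ atom_set Ss).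
have -> : \sum_(n <= i < m) (dyadic_weight i)%:C%C *
    ip (dyadic_atom i) (fun x => \sum_(n <= j < m) (dyadic_weight j)%:C%C * dyadic_atom j x) =
    (\sum_(n <= i < m) \sum_(n <= j < m)
      dyadic_weight i * (dyadic_weight j * atom_gram i j))%:C%C.
  rewrite rmorph_sum; apply: eq_bigr => i _.
  rewrite (rkhs_ip_conj Ss (atom_set i)) (rkhs_ip_suml _ _ atom_set (atom_set i)).
  rewrite -mulr_sumr rmorphM; congr (_ * _); rewrite !rmorph_sum; apply: eq_bigr => j _ /=.
  by rewrite ip_atom -rmorphM conj_real /atom_gram mulrC [dyadic_radius i * _]mulrC mulrC.
rewrite lecR; apply: le_trans (_ : _ <= (\sum_(n <= i < m) (2 ^+ i)^-1) ^+ 2) _.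
  rewrite expr2 mulr_suml; apply: ler_sum => i _; rewrite mulr_sumr.
  apply: ler_sum => j _; rewrite -(weight_expr4 i) -(weight_expr4 j).
  have -> : dyadic_weight i * 4 ^+ i * (dyadic_weight j * 4 ^+ j) =
      dyadic_weight i * (dyadic_weight j * (4 ^+ i * 4 ^+ j)) by ring.
  by rewrite !ler_wpM2l ?atom_gram_le // ltW ?weight_gt0.
have h0 : 0 <= \sum_(n <= i < m) (2 ^+ i)^-1 :> R.
  by apply: sumr_ge0 => i _; rewrite invr_ge0 exprn_ge0.
have p1 : 0 < (2 ^+ n)^-1 :> R by rewrite invr_gt0 exprn_gt0.
have p2 : (2 ^+ n)^-1 <= 1 :> R by rewrite invf_le1 ?exprn_gt0 // exprn_ege1 // ler1n.
have h := sum_half_le n m; rewrite /b.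
apply: le_trans (_ : _ <= (2 / 2 ^+ n) * (2 / 2 ^+ n)) _; first by rewrite expr2 ler_pM.
rewrite mulrACA -natrM ler_wpM2l // ler_piMl //; exact: ltW.
Qed.

Lemma exists_dyadic_limit : exists2 phi, S phi &
  forall g, S g -> tends (fun J => ip (dyadic_multiplier i0 i1 J) g) (ip phi g).
Proof.
apply: (@rkhs_cvg _ _ _ H _ (fun n => 4 / 2 ^+ n) dyadic_multiplier_set).
  rewrite -(mulr0 4); apply: cvgM; first exact: cvg_cst.
  have -> : (fun n => (2 ^+ n)^-1) = (fun n => 2^-1 ^+ n) :> (nat -> R).
    by apply/funext => n; rewrite exprVn.
  by apply: cvg_expr; rewrite ger0_norm ?invf_lt1 // ltr1n.
move=> m n; have b0 k : 0 <= 4 / 2 ^+ k :> R by rewrite divr_ge0 ?exprn_ge0.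
have Sm := dyadic_multiplier_set.
have [mn|nm] := leqP m n; last first.
  apply: le_trans (dyadic_multiplier_cauchy_le (ltnW nm)) _.
  by rewrite lecR lerDr.
have -> : (fun x => dyadic_multiplier i0 i1 m x - dyadic_multiplier i0 i1 n x) =
    (fun x => -1 * (dyadic_multiplier i0 i1 n x - dyadic_multiplier i0 i1 m x)) :> (ball -> C).
  by apply/funext => x; rewrite mulN1r opprB.
have Sd := rkhs_setB (Sm n) (Sm m).
rewrite (rkhs_ipZl _ Sd (rkhs_setZ _ Sd)) (rkhs_ipZr _ Sd Sd).
rewrite rmorphN rmorph1 !mulN1r opprK.
apply: le_trans (dyadic_multiplier_cauchy_le mn) _.
by rewrite lecR lerDl.
Qed.

End Unbounded.

Section Blowup.
Variables (R : realType) (d : nat) (H : drury_arveson R d) (i0 i1 : 'I_d).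
Hypothesis i01 : i1 != i0.
Local Notation C := R[i].
Local Notation ball := (unit_ball R d).
Local Notation K := (@drury_arveson_kernel R d).
Local Notation ip := (rkhs_ip H).
Local Notation S := (rkhs_set H).
Local Notation dyadic_atom := (@dyadic_atom R d i0 i1).
Local Notation dyadic_radius := (@dyadic_radius R).
Local Notation dyadic_weight := (@dyadic_weight R).
Local Notation atom_gram := (@atom_gram R).
Variable phi : ball -> C.
Hypotheses (Sphi : S phi)
  (phi_lim : forall g, S g -> tends (fun J => ip (dyadic_multiplier i0 i1 J) g) (ip phi g)).

Lemma dyadic_limit_Mult : Mult H phi.
Proof.
apply: (@Mult_of_psd _ _ _ H (dyadic_multiplier i0 i1) _ (carleson_const R)).
- by rewrite mulr_ge0 ?exprn_ge0.
- move=> x; have := phi_lim (rkhs_kernel H x).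
  rewrite (rkhs_reproducing x Sphi); apply: tends_ext => J.
  exact: rkhs_reproducing x (dyadic_multiplier_set H i01 J).
exact: psd_dyadic_multiplier.
Qed.

(** The inner product is a series of nonnegative terms, of which only the
    diagonal one is kept. *)
Lemma ip_limit_atom_ge j : (dyadic_weight j * atom_gram j j)%:C%C <= ip phi (dyadic_atom j).
Proof.
have Sa := atom_set H i01 j.
apply: (tends_le _ (tends_cst _) (@tends_shift _ _ _ j.+1 (phi_lim Sa))) => n.
rewrite (ip_dyadic_multiplier i01 _ Sa).
have -> : \sum_(0 <= i < j.+1 + n) (dyadic_weight i)%:C%C * ip (dyadic_atom i) (dyadic_atom j) =
    (\sum_(0 <= i < j.+1 + n) dyadic_weight i * atom_gram i j)%:C%C.
  rewrite rmorph_sum; apply: eq_bigr => i _.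
  by rewrite (ip_atom H i01) -rmorphM.
rewrite lecR (big_cat_nat (n := j.+1)) ?leq_addr //= big_nat_recr //=.
have h i : 0 <= dyadic_weight i * atom_gram i j.
  by rewrite mulr_ge0 ?(ltW (weight_gt0 _ _)) ?(ltW (atom_gram_gt0 _ _ _)).
by rewrite -addrA [X in _ + X]addrC addrA lerDr addr_ge0 ?sumr_ge0.
Qed.

(** The function [K(., z) phi] of the Sarason function, at [z = r_J e_0]. *)
Definition kernel_times J w : C := K w (slice_point i01 (dyadic_radius J) 0) * phi w.

Lemma kernel_times_set J : S (kernel_times J).
Proof.
have := dyadic_limit_Mult (rkhs_kernel H (slice_point i01 (dyadic_radius J) 0)).
by congr (S _); apply/funext => w; rewrite mulrC.
Qed.

(** The points in the difference quotients for [dyadic_atom j] differ only in the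
    coordinate [i1], on which the kernel at [slice_point (dyadic_radius J) 0]
    does not depend. *)
Lemma ip_kernel_times_atom J j :
  ip (kernel_times J) (dyadic_atom j) =
  ((1 - dyadic_radius j * dyadic_radius J)^-1)%:C%C * ip phi (dyadic_atom j).
Proof.
have [r0 r1] := radius_range R j; have [q0 q1] := radius_range R J.
apply: tends_unique (tends_ip_atom i01 (kernel_times_set J)) _.
apply: tends_ext (tendsM (tends_cst _) (tends_ip_atom i01 Sphi)) => n.
rewrite /diff_quotient /kernel_times.
have s := step_in_ball r0 r1 n; have c := center_in_ball r0 r1.
have c' := center_in_ball q0 q1.
rewrite (kernel_points i01 s c') (kernel_points i01 c c') !mulr0 subr0.
by ring.
Qed.

(** With [q = 4^-j], both [1 - r_j * r_J] and [1 - r_j^2] are at most [2 * q],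
    while the two weights contribute [q^3]. *)
Lemma diagonal_term_ge J j : (j <= J)%N ->
  8^-1 <=
  dyadic_weight j * ((1 - dyadic_radius j * dyadic_radius J)^-1 * (dyadic_weight j * atom_gram j j)).
Proof.
move=> jJ; set q := (4 ^+ j)^-1 : R.
have p0 : 0 < 4 ^+ j :> R by rewrite exprn_gt0.
have q0 : 0 < q by rewrite invr_gt0.
have [a0 a1] := radius_range R j; have [b0 b1] := radius_range R J.
have rq : dyadic_radius j = 1 - q by [].
have rJ : 1 - q <= dyadic_radius J.
  by rewrite lerD2l lerN2 lef_pV2 ?posrE ?exprn_gt0 // ler_weXn2l // ler1n.
have w2 : dyadic_weight j * dyadic_weight j = q ^+ 3.
  rewrite /dyadic_weight /q -invfM -exprMn exprVn exprAC.
  by congr (_ ^+ _)^-1; rewrite -natrM -natrX.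
have h1 : (2 * q)^-1 <= (1 - dyadic_radius j * dyadic_radius J)^-1.
  rewrite lef_pV2 ?posrE ?mulr_gt0 ?radiusM_lt1 //.
  have := ler_wpM2l a0 rJ; have := sqr_ge0 q; rewrite rq expr2; lra.
have h2 : (2 * q) ^- 2 <= atom_gram j j.
  rewrite /atom_gram lef_pV2 ?posrE ?exprn_gt0 ?radiusM_lt1 ?mulr_gt0 //.
  rewrite ler_pXn2r ?nnegrE ?(ltW (radiusM_lt1 _ _ _)) ?mulr_ge0 ?(ltW q0) //.
  by have := sqr_ge0 q; rewrite rq expr2; lra.
have -> : 8^-1 = q ^+ 3 * ((2 * q)^-1 * (2 * q) ^- 2) by field; rewrite gt_eqF.
have -> : dyadic_weight j * ((1 - dyadic_radius j * dyadic_radius J)^-1 *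
    (dyadic_weight j * atom_gram j j)) =
    q ^+ 3 * ((1 - dyadic_radius j * dyadic_radius J)^-1 * atom_gram j j) by rewrite -w2; ring.
rewrite ler_wpM2l ?exprn_ge0 ?(ltW q0) //.
by rewrite ler_pM ?invr_ge0 ?exprn_ge0 ?mulr_ge0 ?(ltW q0).
Qed.

Lemma ip_kernel_times_ge J : (J%:R / 8)%:C%C <= ip phi (kernel_times J).
Proof.
have Sk := kernel_times_set J.
apply: (tends_le _ (tends_cst _) (@tends_shift _ _ _ J (phi_lim Sk))) => n.
rewrite (ip_dyadic_multiplier i01 _ Sk).
have w0 j : 0 <= dyadic_weight j by exact/ltW/weight_gt0.
pose c j := dyadic_weight j * ((1 - dyadic_radius j * dyadic_radius J)^-1 *
  (dyadic_weight j * atom_gram j j)).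
have g0 j : 0 <= (1 - dyadic_radius j * dyadic_radius J)^-1 *
    (dyadic_weight j * atom_gram j j).
  apply: mulr_ge0; first by rewrite invr_ge0; exact/ltW/radiusM_lt1.
  by apply: mulr_ge0; [exact: w0 | exact/ltW/atom_gram_gt0].
have c0 j : 0 <= c j by apply: mulr_ge0; [exact: w0 | exact: g0].
have hc j : (c j)%:C%C <= (dyadic_weight j)%:C%C * ip (dyadic_atom j) (kernel_times J).
  have Sa := atom_set H i01 j.
  rewrite (rkhs_ip_conj Sk Sa) ip_kernel_times_atom rmorphM.
  rewrite ler_wpM2l ?ler0c //.
  have h : ((1 - dyadic_radius j * dyadic_radius J)^-1 *
      (dyadic_weight j * atom_gram j j))%:C%C <=
      ((1 - dyadic_radius j * dyadic_radius J)^-1)%:C%C * ip phi (dyadic_atom j).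
    rewrite rmorphM ler_wpM2l ?ip_limit_atom_ge //.
    by rewrite ler0c invr_ge0 ltW ?radiusM_lt1.
  rewrite conj_Creal //; apply: ger0_real; apply: le_trans h.
  by rewrite ler0c g0.
apply: le_trans (_ : _ <= (\sum_(0 <= j < J + n) c j)%:C%C) _; last first.
  by rewrite rmorph_sum; apply: ler_sum => j _; exact: hc.
rewrite lecR (big_cat_nat (n := J)) ?leq_addr //=.
rewrite -[leLHS]addr0 lerD ?sumr_ge0 //.
apply: le_trans (_ : _ <= \sum_(0 <= j < J) 8^-1) _.
  by rewrite sumr_const_nat subn0 mulr_natl.
by apply: ler_sum_nat => j /andP[_ /ltnW jJ]; exact: diagonal_term_ge.
Qed.

Lemma Sarason_unbounded : ~ bounded_fun (fun z => complex.Re (Sarason H phi z)).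
Proof.
case=> M [_ hM]; have {hM} := hM (M + 1); rewrite ltrDl ltr01 => /(_ isT) hM.
pose N := norm_of ip phi ^+ 2; pose t := 4 * (M + 1 + N).
have [J tJ] : exists J : nat, t < J%:R.
  by exists (Num.bound `|t|); exact: le_lt_trans (ler_norm t) (archi_boundP (normr_ge0 t)).
have := hM (slice_point i01 (dyadic_radius J) 0) I.
apply/negP; rewrite -ltNge; apply: lt_le_trans (ler_norm _).
have := ip_kernel_times_ge J; rewrite /Sarason -/(kernel_times J).
move: tJ; rewrite /t /N; move: (norm_of ip phi) (ip phi (kernel_times J)) => a [x y].
rewrite lecE /= => tJ /andP[_ hx].
by move: tJ hx; rewrite !expr2; lra.
Qed.

End Blowup.

Theorem proposition8p1 (R : realType) (d : nat) (hd : (2 <= d)%N)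
    (H2d : drury_arveson R d) :
  exists2 phi : unit_ball R d -> R[i], Mult H2d phi &
    ~ bounded_fun (fun z => complex.Re (Sarason H2d phi z)).
Proof.
pose i0 : 'I_d := Ordinal (ltnW hd); pose i1 : 'I_d := Ordinal hd.
have i01 : i1 != i0 by [].
have [phi Sphi phi_lim] := exists_dyadic_limit H2d i01.
exists phi; first exact: (dyadic_limit_Mult i01 Sphi phi_lim).
exact: (Sarason_unbounded i01 Sphi phi_lim).
Qed.
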